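(* Suppose $\theta$ is $\mathrm{Exp}(1)$. There exist constants $c_1,c_2>0$, independent of $n$, such that for all $n\ge 2$ the mixing time of the gap process satisfies $$c_1n\le t_{\mathrm{mix}}\le c_2\,n(\log n)^2.$$
   Context: Fix $n\ge 2$. The $n$-particle Stochastic Follow-the-Leader system $\mathbf{X}=(X_1,\dots,X_n)$ on $\mathbb{R}$, with $X_n(t)<\dots<X_1(t)$, evolves as a pure jump Markov process: the leader $X_1$ jumps forward at rate $1$ with i.i.d. jump sizes of law $\theta$; for $i\ge 2$, particle $X_i$ jumps at rate $X_{i-1}-X_i$ to a location chosen uniformly in $(X_i,X_{i-1})$. The gap process $\mathbf{Y}=(Y_1,\dots,Y_{n-1})$, $Y_i=X_i-X_{i+1}$, is a Markov process on $\mathbb{R}_+^{n-1}$ with unique stationary distribution $\pi_n$. For $\mu$ a probability measure on $\mathbb{R}_+^{n-1}$, let $\mathbb{P}^t(\mu,A)=\mathbb{P}_\mu(\mathbf{Y}(t)\in A)$ where $\mathbf{Y}(0)\sim\mu$. Define $d(t)=\sup_{\mu}\|\mathbb{P}^t(\mu,\cdot)-\pi_n\|_{TV}$ (supremum over all probability measures on $\mathbb{R}_+^{n-1}$), $t_{\mathrm{mix}}(\varepsilon)=\inf\{t\ge0:d(t)\le\varepsilon\}$ and $t_{\mathrm{mix}}=t_{\mathrm{mix}}(1/4)$. *)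

(* Defs.v *)
From HB Require Import structures.
From mathcomp Require Import all_boot all_order all_algebra.
From mathcomp Require Import all_classical all_reals all_analysis.
Set Implicit Arguments. Unset Strict Implicit. Unset Printing Implicit Defensive.
Import Order.TTheory GRing.Theory Num.Theory.
Local Open Scope classical_set_scope.
Local Open Scope ring_scope.

(* Gap process of the n-particle Stochastic Follow-the-Leader system with
   theta = Exp(1).  The state space is R_+^m with m = n-1, represented as
   m.-tuple R with its product (tnth-generated) sigma-algebra; coordinate
   i : 'I_m is the gap Y_{i+1} = X_{i+1} - X_{i+2}. *)

Section SFTL.
Variable R : realType.
Variable m : nat.
Notation T := (m.-tuple R).
Notation leb := (@lebesgue_measure R).

(* total jump rate: 1 (leader) + sum_j Y_j (particle j+1 jumps at rate Y_j) *)
Definition sftl_rate (y : T) : R := 1 + \sum_(i < m) tnth y i.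

Definition leader_jump (y : T) (e : R) : T :=
  [tuple (if (i : nat) == 0%N then tnth y i + e else tnth y i) | i < m].

(* particle j+2 (follower of the gap j) jumps to X_{j+2} + u * Y_j,
   u uniform in (0,1): gap j becomes (1-u) Y_j, gap j+1 (if any)
   grows by u Y_j *)
Definition follower_jump (y : T) (j : 'I_m) (u : R) : T :=
  [tuple (if i == j then tnth y j - u * tnth y j
          else if (i : nat) == j.+1 then tnth y i + u * tnth y j
          else tnth y i) | i < m].

(* jump operator: (J f)(y) = int f dQ(y,.) where Q(y,.) is the (unnormalized)
   jump-rate measure of the gap process *)
Definition sftl_jump (y : T) (f : T -> \bar R) : \bar R :=
  ((\int[leb]_(e in `[(0%R:R), +oo[%classic) ((expR (- e)%R)%:E * f (leader_jump y e)))
   + \sum_(j < m) ((tnth y j)%:E *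
        \int[leb]_(u in `[(0%R:R), 1%R]%classic) f (follower_jump y j u)))%E.

(* Feller's iterative construction of the transition function of the
   (minimal) pure jump process: P_k t y A = P_y(Y(t) in A, exactly k jumps
   in [0,t]) *)
Fixpoint sftl_Pk (k : nat) (t : R) (y : T) (A : set T) : \bar R :=
  match k with
  | 0%N => ((expR (- (sftl_rate y * t))%R)%:E * (\1_A y)%:E)%E
  | k'.+1 => \int[leb]_(s in `[(0%R:R), t]%classic)
               ((expR (- (sftl_rate y * s))%R)%:E *
                sftl_jump y (fun z => sftl_Pk k' (t - s)%R z A))%E
  end.

Definition sftl_P (t : R) (y : T) (A : set T) : \bar R :=
  (\sum_(0 <= k <oo) sftl_Pk k t y A)%E.

Definition sftl_Pmu (mu : set T -> \bar R) (t : R) (A : set T) : \bar R :=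
  (\int[mu]_y sftl_P t y A)%E.

(* the state space R_+^m (gaps are positive since X_n < ... < X_1) *)
Definition gap_space : set T := [set y | forall i, 0 < tnth y i].

Definition tv_dist (f g : set T -> \bar R) : \bar R :=
  ereal_sup [set `|(f A - g A)%E|%E | A in [set A : set T | measurable A]].

Definition sftl_stationary (pi : probability T R) : Prop :=
  pi gap_space = 1%E /\
  forall t, 0 <= t -> forall A, measurable A -> sftl_Pmu pi t A = pi A.

Definition sftl_d (pi : probability T R) (t : R) : \bar R :=
  ereal_sup [set tv_dist (sftl_Pmu mu t) pi |
             mu in [set mu : probability T R | mu gap_space = 1%E]].

Definition sftl_tmix_eps (pi : probability T R) (eps : R) : \bar R :=
  ereal_inf [set t%:E | t in [set t : R | 0 <= t /\ (sftl_d pi t <= eps%:E)%E]].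

Definition sftl_tmix (pi : probability T R) : \bar R :=
  sftl_tmix_eps pi (1 / 4).

End SFTL.

(* Main.v *)
(* Couple two systems through common leader jumps and common Poisson
   points for the followers: each particle sees the same proposed target locations,
   and jumps when the target lies in its own gap. Started from all gaps equal to
   zero, a follower cannot jump before its predecessor has, and when it jumps for
   the first time it meets the corresponding particle of any other system whose
   predecessors have already coalesced. Hence two gap processes agree as soon as
   the last particle of the system started from zero has jumped. The time of that
   jump has exponential tails at scale n, by the Lyapunov function
   sum_i (1 - i/2m) y_i + 56 m exp(- sum_i y_i / 6m), where m = n - 1. This gives the
   upper bound in the stronger form C n log n. For the lower bound, start from tiny
   gaps; the distances Z_i = y_i + ... + y_m to the last particle satisfy a closed
   linear system of differential inequalities for functions increasing in Z_i, so
   that with high probability the last gap is still tiny at time c n, which it is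
   not under the stationary law. Both estimates are transferred to the Feller
   iterates by induction on the number of jumps. *)
Require Import Defs.
From HB Require Import structures.
From mathcomp Require Import all_boot all_order all_algebra.
From mathcomp Require Import all_classical all_reals all_analysis.
From mathcomp Require Import measurable_realfun exponential_distribution ring lra.
Set Implicit Arguments. Unset Strict Implicit. Unset Printing Implicit Defensive.
Import Order.TTheory GRing.Theory Num.Theory.
Import numFieldNormedType.Exports.
Local Open Scope classical_set_scope.
Local Open Scope ring_scope.

(** * Integrals *)

(** No path or joint process is constructed. The coupling becomes an inequality between solutions of
    backward equations: the truncated series started from [y] is at most the full series started
    from [z], plus [exp(-lam t) V z]. The larger gaps of [y] make it jump more often than [z], so
    the numbers of jumps of the two copies cannot be matched: only the series of [y] is truncated,
    and the equation of [z] is rewritten at the rate of [y] with phantom jumps. This comparison is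
    one-sided. Passing to the complement of the event gives the other side, but only if the minimal
    process has total mass one, and so non-explosion must be proved. The Lyapunov function has two
    parts because two regimes occur. Let r be the mean gap. Follower jumps lower the linear part at
    rate at least r^2/4, which beats the leader only when r is not small; for small r the leader
    itself lowers the exponential part. For the speed bound, a ratio 32 between consecutive weights
    gives growth rate 2 * 32 + 1 = 65 against an initial value of order 32^(-m), so times up to a
    small multiple of m are harmless. *)

Section integrals.
Local Open Scope ereal_scope.
Import HBNNSimple.

(** The integral of a nonnegative function is a supremum over simple functions below it, so
    monotonicity needs no measurability. This spares measurability proofs for the unclamped
    integrands. *)
Lemma ge0_le_integral_nomeas d (T : measurableType d) (R : realType)
  (mu : {measure set T -> \bar R}) (D : set T) (f g : T -> \bar R) :
  (forall x, D x -> 0 <= f x) -> (forall x, D x -> f x <= g x) ->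
  \int[mu]_(x in D) f x <= \int[mu]_(x in D) g x.
Proof.
move=> f0 fg; have g0 x : D x -> 0 <= g x.
  by move=> Dx; rewrite (le_trans (f0 x Dx)) ?fg.
rewrite !ge0_integralE//; apply: le_ereal_sup => _ [h hf <-].
exists h => // x.
by apply: (le_trans (hf x)); apply: lee_restrict.
Qed.

Variable R : realType.
Notation leb := (@lebesgue_measure R).

(** The push-forward of Lebesgue measure under [a * x + b], scaled by [a], agrees with Lebesgue
    measure on half-open intervals, hence everywhere by uniqueness. *)
Lemma ge0_integral_affine (a b : R) (D : set R) (f : R -> \bar R) :
  (0 < a)%R -> measurable D -> measurable_fun D f ->
  (forall x, D x -> 0 <= f x) ->
  \int[leb]_(x in D) f x =
  a%:E * \int[leb]_(x in (fun x => (a * x + b)%R) @^-1` D) f (a * x + b)%R.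
Proof.
move=> a0 mD mf f0.
pose phi : measurableTypeR R -> measurableTypeR R := fun x => (a * x + b)%R.
have mphi : measurable_fun setT phi.
  by apply: measurable_funD => //; apply: measurable_funM.
pose mu2f : {measure set (measurableTypeR R) -> \bar R} :=
  mscale (NngNum (ltW a0)) (pushforward leb phi).
pose mu2 := mu2f mphi.
have -> : \int[leb]_(x in D) f x = \int[mu2]_(x in D) f x.
  apply: eq_measure_integral => A mA _.
  apply: (@lebesgue_measure_unique R mu2) => //.
  move=> _ [[c e]] _ <-.
  rewrite /mu2/= /mu2f/= /mscale/= /pushforward.
  rewrite (_ : phi @^-1` _ = `](c - b) / a, (e - b) / a]%classic)%R; last first.
    apply/seteqP; split => x /=; rewrite !in_itv/= /phi ltr_pdivrMr// ler_pdivlMr//;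
    by rewrite ltrBlDr lerBrDr mulrC.
  rewrite !lebesgue_measure_itv/= !lte_fin ltr_pM2r ?invr_gt0// ltrD2r.
  case: ifPn => _; last by rewrite mule0.
  rewrite -?EFinN -?EFinD -?EFinM; congr EFin.
  rewrite mulrBr !(mulrC a) !divfK ?gt_eqF//; ring.
rewrite /mu2 /mu2f ge0_integral_mscale//; congr (_ * _).
by rewrite ge0_integral_pushforward// => x /set_mem /f0.
Qed.

(** The factor [a] is kept on the left so that every real [a] is allowed: zero occurs when two jump
    rates coincide, and negative values give growing exponentials. *)
Lemma integral_itv0_expN (a t : R) : (0 <= t)%R ->
  a%:E * \int[leb]_(s in `[0%R, t]%classic) (expR (- (a * s)))%:E
  = (1 - expR (- (a * t)))%:E.
Proof.
rewrite le_eqVlt => /predU1P[<-|t0].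
  by rewrite set_itv1 integral_set1 mulr0 oppr0 expR0 subrr mule0.
have [->|a0] := eqVneq a 0%R.
  by rewrite mul0e mul0r oppr0 expR0 subrr.
have der (x : R) : is_derive x 1%R (fun s => (- a^-1 * expR (- (a * s)))%R)
   (expR (- (a * x))).
  have H : is_derive x 1%R (fun s => - (a * s))%R (- a)%R.
    rewrite (_ : (fun s => _) = -%R \o (fun s => a * s)%R)//.
    apply: is_deriveN.
    have := @is_deriveZ R R R id a x 1%R 1%R (is_derive_id x 1%R).
    by rewrite /GRing.scale/= mulr1.
  have H1 := @is_derive1_comp R expR (fun s => - (a * s))%R x _ _ (is_derive_expR _) H.
  have H2 := @is_deriveZ R R R _ (- a^-1)%R x 1%R _ H1.
  apply: (is_derive_eq H2).
  by rewrite /GRing.scale/= mulrCA mulrNN mulVf// mulr1.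
have cexp : continuous (fun s : R => expR (- (a * s))).
  move=> x; apply: continuous_comp; last exact: continuous_expR.
  apply: (@continuousN _ R^o); apply: (@continuousM _ R^o); [exact: cst_continuous|exact: id].
rewrite (@continuous_FTC2 R (fun s => expR (- (a * s)))
   (fun s => (- a^-1 * expR (- (a * s)))%R) 0%R t) //.
- rewrite mulr0 oppr0 expR0 -EFinN -EFinD -EFinM; congr EFin.
  by field.
- exact: continuous_subspaceT.
- have cF : continuous (fun s : R => (- a^-1 * expR (- (a * s)))%R).
    move=> x; apply: (@continuousM _ R^o (fun=> - a^-1)%R (fun s => expR (- (a * s)))).
      exact: cst_continuous.
    exact: cexp.
  split.
  + by move=> x _; apply: ex_derive; exact: der.
  + by apply: cvg_at_right_filter; apply: cF.
  + by apply: cvg_at_left_filter; apply: cF.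
- by move=> x _; rewrite derive1E; exact: derive_val.
Qed.

Lemma integral_itv0y_expN (a : R) : (0 < a)%R ->
  \int[leb]_(s in `[0%R, +oo[%classic) (expR (- (a * s)))%:E = (a^-1)%:E.
Proof.
move=> a0.
have a0' := ltW a0.
have := integral_exponential_pdf a0.
rewrite (_ : (fun x => _) = (fun x => a%:E * (expR (- (a * x)))%:E) \_ `[0%R, +oo[%classic); last first.
  by apply/funext => x; rewrite /exponential_pdf !patchE; case: ifPn => //; rewrite mulNr.
rewrite -integral_mkcond ge0_integralZl_EFin//; last first.
  apply: measurable_funTS; apply/measurable_EFinP; apply: measurableT_comp => //.
  by apply: measurableT_comp => //; apply: measurable_funM.
by move=> H; rewrite -[RHS]mule1 -H muleA -EFinM mulVf ?gt_eqF// mul1e.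
Qed.

Lemma integral_itv01_onem :
  \int[leb]_(u in `[0%R, 1%R]%classic) (1 - u)%:E = (2^-1)%:E.
Proof.
have der (x : R) : is_derive x 1%R (fun s : R => s - 2^-1 * s ^+ 2)%R (1 - x)%R.
  by apply: is_derive_eq; rewrite /GRing.scale/= ?expr1 ?mulr1; field.
have cF : continuous (fun s : R => (s - 2^-1 * s ^+ 2)%R).
  move=> x; apply: (@continuousB _ R^o R^o id (fun s => 2^-1 * s ^+ 2)%R); first exact: id.
  apply: (@continuousM _ R^o (fun=> 2^-1)%R (fun s => s ^+ 2)%R).
    exact: cst_continuous.
  exact: exprn_continuous.
rewrite (@continuous_FTC2 R (fun u => 1 - u)%R (fun s => s - 2^-1 * s ^+ 2)%R 0%R 1%R) //.
- by rewrite expr0n/= mulr0 expr1n mulr1 subrr sube0; congr EFin; field.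
- apply: continuous_subspaceT => x.
  apply: (@continuousB _ R^o R^o (fun=> 1%R) id); [exact: cst_continuous|exact: id].
- split.
  + by move=> x _; apply: ex_derive; exact: der.
  + by apply: cvg_at_right_filter; apply: cF.
  + by apply: cvg_at_left_filter; apply: cF.
- by move=> x _; rewrite derive1E; exact: derive_val.
Qed.

End integrals.

(** * Measurability of the jumps *)

Section jump_operator.
Local Open Scope ereal_scope.
Variable R : realType.
Notation leb := (@lebesgue_measure R).

(** The domain may vary with [x]; the iterates integrate over [[0, t]] with [t] itself an argument.
    Restricting the integrand to [E] reduces this to Tonelli. *)
Lemma measurable_fun_section_integral d (X : measurableType d)
    (E : set (X * R)) (h : X * R -> \bar R) :
  measurable E -> measurable_fun setT h -> (forall p, 0 <= h p) ->
  measurable_fun setT (fun x => \int[leb]_(s in [set s | E (x, s)]) h (x, s)).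
Proof.
move=> mE mh h0.
rewrite (_ : (fun x => _) = fubini_F leb (h \_ E)); last first.
  apply/funext => x; rewrite integral_mkcond /fubini_F; apply: eq_integral => s _.
  rewrite !patchE; have -> // : (s \in [set s | E (x, s)]) = ((x, s) \in E).
  by apply/idP/idP => /set_mem H; apply/mem_set.
apply: measurable_fun_fubini_tonelli_F => [|x]; last exact: erestrict_ge0.
by have := (measurable_restrictT h mE).1 (measurable_funTS mh).
Qed.

Lemma measurable_fun_integral_snd d (X : measurableType d)
    (D : set R) (h : X -> R -> \bar R) :
  measurable D -> measurable_fun setT (fun p : X * R => h p.1 p.2) ->
  (forall x s, 0 <= h x s) ->
  measurable_fun setT (fun x => \int[leb]_(s in D) h x s).
Proof.
move=> mD mh h0.
have := @measurable_fun_section_integral _ _ (setT `*` D) _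
  (measurableX measurableT mD) mh (fun p => h0 p.1 p.2).
rewrite (_ : (fun x => _) = (fun x => \int[leb]_(s in D) h x s))//.
apply/funext => x; congr (integral _ _ _).
by apply/seteqP; split => [s []|s].
Qed.

Variable m : nat.
Notation T := (m.-tuple R).

Definition nonneg_gaps (y : T) := forall i, (0 <= tnth y i)%R.

(* Outside the nonnegative orthant some jump rates are negative and [sftl_Pk] can be
   meaningless; precomposing with the projection onto the orthant gives functions that
   are nonnegative and measurable on the whole space. *)
Definition clamp_gaps (y : T) : T := [tuple Num.max 0%R (tnth y i) | i < m].

Lemma clamp_gaps_ge0 y : nonneg_gaps (clamp_gaps y).
Proof. by move=> i; rewrite tnth_mktuple le_max lexx. Qed.

Lemma clamp_gaps_id y : nonneg_gaps y -> clamp_gaps y = y.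
Proof.
by move=> y0; apply: eq_from_tnth => i; rewrite tnth_mktuple; apply/max_idPr.
Qed.

Lemma leader_jump_ge0 (y : T) (e : R) :
  nonneg_gaps y -> (0 <= e)%R -> nonneg_gaps (leader_jump y e).
Proof.
by move=> y0 e0 i; rewrite tnth_mktuple; case: ifP => // _; rewrite addr_ge0.
Qed.

Lemma follower_jump_ge0 (y : T) j (u : R) :
  nonneg_gaps y -> (0 <= u <= 1)%R -> nonneg_gaps (follower_jump y j u).
Proof.
move=> y0 /andP[u0 u1] i; rewrite tnth_mktuple; case: ifP => _.
  by rewrite subr_ge0 ler_piMl.
by case: ifP => // _; rewrite addr_ge0// mulr_ge0.
Qed.

Lemma measurable_clamp_gaps : measurable_fun setT clamp_gaps.
Proof.
apply/measurable_fun_tnthP => i.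
rewrite (_ : _ \o _ = fun y : T => Num.max 0%R (tnth y i)); last first.
  by apply/funext => y /=; rewrite tnth_mktuple.
by apply: measurable_maxr => //; exact: measurable_tnth.
Qed.

Lemma measurable_sftl_rate : measurable_fun setT (@sftl_rate R m).
Proof.
apply: measurable_funD => //; apply: measurable_sum => i; exact: measurable_tnth.
Qed.

Section joint.
Context d (X : measurableType d) (g : X -> T).
Hypothesis mg : measurable_fun setT g.

Lemma measurable_tnth_comp i : measurable_fun setT (fun x => tnth (g x) i).
Proof. by move/measurable_fun_tnthP: mg => /(_ i). Qed.

Lemma measurable_leader_jump :
  measurable_fun setT (fun p : X * R => leader_jump (g p.1) p.2).
Proof.
apply/measurable_fun_tnthP => i.
rewrite (_ : _ \o _ = fun p : X * R => if (i : nat) == 0%N then (tnth (g p.1) i + p.2)%R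
  else tnth (g p.1) i); last by apply/funext => y /=; rewrite tnth_mktuple.
have H : measurable_fun setT (fun p : X * R => tnth (g p.1) i).
  exact: (measurableT_comp (measurable_tnth_comp i)).
by case: ((i : nat) == 0%N); [apply: measurable_funD|].
Qed.

Lemma measurable_follower_jump j :
  measurable_fun setT (fun p : X * R => follower_jump (g p.1) j p.2).
Proof.
apply/measurable_fun_tnthP => i.
rewrite (_ : _ \o _ = fun p : X * R =>
  if i == j then (tnth (g p.1) j - p.2 * tnth (g p.1) j)%R
  else if (i : nat) == j.+1 then (tnth (g p.1) i + p.2 * tnth (g p.1) j)%R
  else tnth (g p.1) i); last by apply/funext => y /=; rewrite tnth_mktuple.
have H k : measurable_fun setT (fun p : X * R => tnth (g p.1) k).
  exact: (measurableT_comp (measurable_tnth_comp k)).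
case: (i == j); first by apply: measurable_funB => //; apply: measurable_funM.
by case: ((i : nat) == j.+1) => //; apply: measurable_funD => //; apply: measurable_funM.
Qed.

Variable F : X -> T -> \bar R.
Hypothesis mF : measurable_fun setT (fun p : X * T => F p.1 p.2).
Hypothesis F0 : forall x y, 0 <= F x y.

Lemma measurable_leader_arg :
  measurable_fun setT (fun p : X * R => F p.1 (leader_jump (g p.1) p.2)).
Proof.
exact: (measurableT_comp mF (measurable_fun_pair measurable_fst measurable_leader_jump)).
Qed.

Lemma measurable_follower_arg j :
  measurable_fun setT (fun p : X * R => F p.1 (follower_jump (g p.1) j p.2)).
Proof.
exact: (measurableT_comp mF (measurable_fun_pair measurable_fst (measurable_follower_jump j))).
Qed.

(** The integrand may depend on the parameter [x] as well as on the state: in the backward equation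
    the remaining time and the starting point vary together. *)
Lemma measurable_sftl_jump : measurable_fun setT (fun x => sftl_jump (g x) (F x)).
Proof.
apply: emeasurable_funD.
  apply: (@measurable_fun_integral_snd _ _ _
    (fun x e => (expR (- e))%:E * F x (leader_jump (g x) e))) => //.
  - apply: emeasurable_funM; last exact: measurable_leader_arg.
    by apply/measurable_EFinP; apply: measurableT_comp => //; apply: measurableT_comp.
  - by move=> x e; rewrite mule_ge0// lee_fin expR_ge0.
apply: emeasurable_sum => j; apply: emeasurable_funM.
  by apply/measurable_EFinP; exact: measurable_tnth_comp.
apply: (@measurable_fun_integral_snd _ _ _
    (fun x u => F x (follower_jump (g x) j u))) => //.
exact: measurable_follower_arg.
Qed.

End joint.
End jump_operator.

(** * The jump operator *)

Section jump_algebra.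
Local Open Scope ereal_scope.
Variables (R : realType) (m : nat).
Notation leb := (@lebesgue_measure R).
Notation T := (m.-tuple R).
Implicit Types (y z : T) (f g : T -> \bar R).

Lemma measurable_leader_fun f y : measurable_fun setT f ->
  measurable_fun setT (fun e => f (leader_jump y e)).
Proof.
move=> mf; apply: (measurableT_comp mf).
exact: (measurableT_comp (@measurable_leader_jump R m _ T id (@measurable_id _ T setT)) (measurable_pair1 y)).
Qed.

Lemma measurable_follower_fun f y j : measurable_fun setT f ->
  measurable_fun setT (fun u => f (follower_jump y j u)).
Proof.
move=> mf; apply: (measurableT_comp mf).
exact: (measurableT_comp (@measurable_follower_jump R m _ T id (@measurable_id _ T setT) j) (measurable_pair1 y)).
Qed.

Lemma measurable_expRN : measurable_fun setT (fun e : R => (expR (- e))%:E).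
Proof. by apply/measurable_EFinP; apply: measurableT_comp. Qed.

Lemma itv0y_ge0 (e : R) : `[0%R, +oo[%classic e -> (0 <= e)%R.
Proof. by rewrite /= in_itv/= andbT. Qed.

Lemma itv01_01 (u : R) : `[0%R, 1%R]%classic u -> (0 <= u <= 1)%R.
Proof. by rewrite /= in_itv. Qed.

Lemma sftl_jump_ge0 y f : nonneg_gaps y ->
  (forall z, nonneg_gaps z -> 0 <= f z) -> 0 <= sftl_jump y f.
Proof.
move=> y0 f0; apply: adde_ge0.
  apply: integral_ge0 => e /itv0y_ge0 e0.
  by rewrite mule_ge0 ?lee_fin ?expR_ge0//; apply: f0; exact: leader_jump_ge0.
apply: sume_ge0 => j _; rewrite mule_ge0 ?lee_fin//.
by apply: integral_ge0 => u /itv01_01 u01; apply: f0; exact: follower_jump_ge0.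
Qed.

Lemma le_sftl_jump y f g : nonneg_gaps y ->
  (forall z, nonneg_gaps z -> 0 <= f z <= g z) ->
  sftl_jump y f <= sftl_jump y g.
Proof.
move=> y0 fg; apply: leeD.
  apply: ge0_le_integral_nomeas => e /itv0y_ge0 e0;
    have /andP[f0 fg'] := fg _ (leader_jump_ge0 y0 e0).
    by rewrite mule_ge0 ?lee_fin ?expR_ge0.
  by rewrite lee_wpmul2l ?lee_fin ?expR_ge0.
apply: lee_sum => j _; rewrite lee_wpmul2l ?lee_fin//.
by apply: ge0_le_integral_nomeas => u /itv01_01 u01;
    have /andP[] := fg _ (follower_jump_ge0 j y0 u01).
Qed.

Lemma eq_sftl_jump y f g : nonneg_gaps y ->
  (forall z, nonneg_gaps z -> f z = g z) ->
  sftl_jump y f = sftl_jump y g.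
Proof.
move=> y0 fg; congr (_ + _).
  apply: eq_integral => e /set_mem /itv0y_ge0 e0; congr (_ * _).
  by apply: fg; exact: leader_jump_ge0.
apply: eq_bigr => j _; congr (_ * _).
apply: eq_integral => u /set_mem /itv01_01 u01.
by apply: fg; exact: follower_jump_ge0.
Qed.

Lemma sftl_jumpD y f g : nonneg_gaps y ->
  measurable_fun setT f -> measurable_fun setT g ->
  (forall z, 0 <= f z) -> (forall z, 0 <= g z) ->
  sftl_jump y (fun z => f z + g z) = sftl_jump y f + sftl_jump y g.
Proof.
move=> y0 mf mg f0 g0; rewrite /sftl_jump addeACA; congr (_ + _).
  rewrite -ge0_integralD//.
  - by apply: eq_integral => e _; rewrite ge0_muleDr.
  - by move=> e _; rewrite mule_ge0 ?lee_fin ?expR_ge0.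
  - apply: measurable_funTS; apply: emeasurable_funM; first exact: measurable_expRN.
    exact: measurable_leader_fun.
  - by move=> e _; rewrite mule_ge0 ?lee_fin ?expR_ge0.
  - apply: measurable_funTS; apply: emeasurable_funM; first exact: measurable_expRN.
    exact: measurable_leader_fun.
rewrite -big_split/=; apply: eq_bigr => j _.
rewrite ge0_integralD//.
- by rewrite ge0_muleDr//; apply: integral_ge0.
- by apply: measurable_funTS; exact: measurable_follower_fun.
- by apply: measurable_funTS; exact: measurable_follower_fun.
Qed.

Lemma sftl_jumpZ y f (c : R) : nonneg_gaps y ->
  measurable_fun setT f -> (forall z, 0 <= f z) -> (0 <= c)%R ->
  sftl_jump y (fun z => c%:E * f z) = c%:E * sftl_jump y f.
Proof.
move=> y0 mf f0 c0; rewrite /sftl_jump ge0_muleDr; last 2 first.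
- by apply: integral_ge0 => e _; rewrite mule_ge0 ?lee_fin ?expR_ge0.
- by apply: sume_ge0 => j _; rewrite mule_ge0 ?lee_fin//; apply: integral_ge0.
congr (_ + _).
  rewrite -ge0_integralZl_EFin//.
  - by apply: eq_integral => e _; rewrite muleCA.
  - by move=> e _; rewrite mule_ge0 ?lee_fin ?expR_ge0.
  - apply: measurable_funTS; apply: emeasurable_funM; first exact: measurable_expRN.
    exact: measurable_leader_fun.
rewrite ge0_sume_distrr => [|j _]; last by rewrite mule_ge0 ?lee_fin//; apply: integral_ge0.
apply: eq_bigr => j _; rewrite muleCA; congr (_ * _).
by rewrite -ge0_integralZl_EFin//; apply: measurable_funTS; exact: measurable_follower_fun.
Qed.

Lemma integral_itv01_cst (x : \bar R) :
  \int[leb]_(u in `[0%R, 1%R]%classic) x = x.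
Proof.
by rewrite integral_cst//= lebesgue_measure_itv/= lte_fin ltr01 oppr0 adde0 mule1.
Qed.

Lemma integral_itv0y_expN1 :
  \int[leb]_(s in `[0%R, +oo[%classic) (expR (- s))%:E = 1.
Proof.
rewrite -[RHS]/(1%R%:E) -[X in X%:E]invr1 -integral_itv0y_expN//.
by apply: eq_integral => s _; rewrite mul1r.
Qed.

Lemma sftl_jump_cst y (c : R) : nonneg_gaps y -> (0 <= c)%R ->
  sftl_jump y (fun=> c%:E) = (sftl_rate y * c)%:E.
Proof.
move=> y0 c0; rewrite /sftl_jump/=.
under eq_integral do rewrite muleC.
rewrite ge0_integralZl_EFin//; last first.
  by apply: measurable_funTS; exact: measurable_expRN.
rewrite integral_itv0y_expN1 mule1 /sftl_rate mulrDl mul1r EFinD; congr (_ + _).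
rewrite mulr_suml -sumEFin; apply: eq_bigr => j _.
by rewrite integral_itv01_cst EFinM.
Qed.

Lemma sftl_jump_sum y (f : nat -> T -> \bar R) (s : seq nat) : nonneg_gaps y ->
  (forall k, measurable_fun setT (f k)) -> (forall k z, 0 <= f k z) ->
  sftl_jump y (fun z => \sum_(k <- s) f k z) = \sum_(k <- s) sftl_jump y (f k).
Proof.
move=> y0 mf f0; elim: s => [|k s ih].
  rewrite big_nil (_ : (fun=> _) = (fun=> 0%R%:E)); last first.
    by apply/funext => z; rewrite big_nil.
  by rewrite sftl_jump_cst// mulr0.
rewrite big_cons -ih -sftl_jumpD//.
- by apply: eq_sftl_jump => // z _; rewrite big_cons.
- exact: emeasurable_sum.
- by move=> z; apply: sume_ge0.
Qed.

Lemma sftl_jump_nneseries y (f : nat -> T -> \bar R) : nonneg_gaps y ->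
  (forall k, measurable_fun setT (f k)) -> (forall k z, 0 <= f k z) ->
  sftl_jump y (fun z => \sum_(0 <= k <oo) f k z) =
  \sum_(0 <= k <oo) sftl_jump y (f k).
Proof.
move=> y0 mf f0; rewrite /sftl_jump nneseriesD; last 2 first.
- by move=> k _ _; apply: integral_ge0 => e _; rewrite mule_ge0 ?lee_fin ?expR_ge0.
- by move=> k _ _; apply: sume_ge0 => j _; rewrite mule_ge0 ?lee_fin//; apply: integral_ge0.
congr (_ + _).
  rewrite -integral_nneseries//; last 2 first.
  - move=> k; apply: measurable_funTS; apply: emeasurable_funM; first exact: measurable_expRN.
    exact: measurable_leader_fun.
  - by move=> k e _; rewrite mule_ge0 ?lee_fin ?expR_ge0.
  by apply: eq_integral => e _; rewrite nneseriesZl.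
rewrite nneseries_sum => [|j k _]; last first.
  by rewrite mule_ge0 ?lee_fin//; apply: integral_ge0.
apply: eq_bigr => j _; rewrite nneseriesZl => [|k _]; last exact: integral_ge0.
congr (_ * _); rewrite -integral_nneseries// => k.
by apply: measurable_funTS; exact: measurable_follower_fun.
Qed.

End jump_algebra.

(** * The transition function *)

Section transition_function.
Local Open Scope ereal_scope.
Variables (R : realType) (m : nat).
Notation leb := (@lebesgue_measure R).
Notation T := (m.-tuple R).
Implicit Types (y z : T) (A : set T).

Lemma sftl_rate_ge0 y : nonneg_gaps y -> (0 <= sftl_rate y)%R.
Proof. by move=> y0; rewrite /sftl_rate addr_ge0// sumr_ge0. Qed.

Lemma itv0t_bounds (t s : R) : `[0%R, t]%classic s -> (0 <= s /\ 0 <= t - s)%R.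
Proof. by rewrite /= in_itv/= subr_ge0 => /andP[]. Qed.

Lemma sftl_Pk_ge0 k t y A : nonneg_gaps y -> 0 <= sftl_Pk k t y A.
Proof.
elim: k t y => [|k ih] t y y0 /=.
  by rewrite mule_ge0 ?lee_fin ?expR_ge0.
apply: integral_ge0 => s _; rewrite mule_ge0 ?lee_fin ?expR_ge0//.
by apply: sftl_jump_ge0 => // z z0; exact: ih.
Qed.

Section fun_of_time.
Variable F : R -> T -> \bar R.
Hypothesis mF : measurable_fun setT (fun p : R * T => F p.1 p.2).
Hypothesis F0 : forall t y, 0 <= F t y.

Lemma measurable_sftl_jump_time y (t : R) :
  measurable_fun setT (fun s : R => sftl_jump y (F (t - s)%R)).
Proof.
apply: (@measurable_sftl_jump R m _ R (fun=> y) _ (fun s => F (t - s)%R)) => //.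
apply: (measurableT_comp mF (measurable_fun_pair _ _)) => //.
by apply: measurable_funB.
Qed.

Lemma measurable_expRN_mul (a : R) : measurable_fun setT (fun s : R => (expR (- (a * s)))%:E).
Proof.
apply/measurable_EFinP; apply: measurableT_comp => //.
by apply: measurableT_comp => //; apply: measurable_funM.
Qed.

Lemma measurable_duhamel :
  measurable_fun setT (fun p : R * T =>
    \int[leb]_(s in `[0%R, p.1]%classic)
      ((expR (- (sftl_rate (clamp_gaps p.2) * s)))%:E *
       sftl_jump (clamp_gaps p.2) (F (p.1 - s)%R))).
Proof.
pose E := [set q : (R * T) * R | (0 <= q.2 <= q.1.1)%R].
have mfst : measurable_fun setT (fun q : (R * T) * R => q.1.1).
  exact: (measurableT_comp measurable_fst measurable_fst).
have mgap : measurable_fun setT (fun q : (R * T) * R => clamp_gaps q.1.2).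
  apply: (measurableT_comp (@measurable_clamp_gaps R m)).
  exact: (measurableT_comp measurable_snd measurable_fst).
have mE : measurable E.
  rewrite (_ : E = [set q | (0 <= q.2)%R] `&` [set q | (q.2 <= q.1.1)%R]).
    apply: measurableI; rewrite -[X in measurable X]setTI.
      by apply: (measurable_fun_le (f := fun=> 0%R) (g := snd)).
    by apply: (measurable_fun_le (f := snd) (g := fun q => q.1.1)).
  by apply/seteqP; split => q /andP.
have := measurable_fun_section_integral mE (h := fun q : (R * T) * R =>
  (expR (- (sftl_rate (clamp_gaps q.1.2) * q.2)))%:E *
       sftl_jump (clamp_gaps q.1.2) (F (q.1.1 - q.2)%R)).
rewrite (_ : (fun x => _) = fun p : R * T =>
    \int[leb]_(s in `[0%R, p.1]%classic)
      ((expR (- (sftl_rate (clamp_gaps p.2) * s)))%:E *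
       sftl_jump (clamp_gaps p.2) (F (p.1 - s)%R))); last first.
  apply/funext => p.
  have -> // : [set s | E (p, s)] = `[0%R, p.1]%classic.
  by apply/seteqP; split => s; rewrite /E/= in_itv.
apply.
- apply: emeasurable_funM.
    apply/measurable_EFinP; apply: measurableT_comp => //.
    apply: measurableT_comp => //; apply: measurable_funM => //.
    exact: (measurableT_comp (@measurable_sftl_rate R m)).
  apply: (@measurable_sftl_jump R m _ _ _ mgap (fun q => F (q.1.1 - q.2)%R)) => //.
  have msub : measurable_fun setT (fun q : (R * T) * R => q.1.1 - q.2)%R.
    exact: measurable_funB.
  exact: (measurableT_comp mF (measurable_fun_pair
    (measurableT_comp msub measurable_fst) measurable_snd)).
- move=> q; rewrite mule_ge0 ?lee_fin ?expR_ge0//.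
  by apply: sftl_jump_ge0 => //; exact: clamp_gaps_ge0.
Qed.

End fun_of_time.

Lemma sftl_PkS k t y A : sftl_Pk k.+1 t y A = \int[leb]_(s in `[0%R, t]%classic)
  ((expR (- (sftl_rate y * s)))%:E * sftl_jump y (fun z => sftl_Pk k (t - s)%R z A)).
Proof. by []. Qed.

Definition clamped_Pk A k (t : R) y := sftl_Pk k t (clamp_gaps y) A.

Lemma clamped_Pk_ge0 A k t y : 0 <= clamped_Pk A k t y.
Proof. by apply: sftl_Pk_ge0; exact: clamp_gaps_ge0. Qed.

Lemma clamped_PkS A k t y : nonneg_gaps y ->
  clamped_Pk A k.+1 t y = \int[leb]_(s in `[0%R, t]%classic)
    ((expR (- (sftl_rate y * s)))%:E * sftl_jump y (clamped_Pk A k (t - s)%R)).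
Proof.
move=> y0; rewrite /clamped_Pk (clamp_gaps_id y0) sftl_PkS.
apply: eq_integral => s _.
rewrite (@eq_sftl_jump _ _ y _ (fun z => sftl_Pk k (t - s) (clamp_gaps z) A) y0) => [//|z z0].
by rewrite clamp_gaps_id.
Qed.

Lemma measurable_clamped_Pk A k : measurable A ->
  measurable_fun setT (fun p : R * T => clamped_Pk A k p.1 p.2).
Proof.
move=> mA; elim: k => [|k ih].
  have mc : measurable_fun setT (fun p : R * T => clamp_gaps p.2).
    exact: (measurableT_comp (@measurable_clamp_gaps R m)).
  apply: emeasurable_funM.
    apply/measurable_EFinP; apply: measurableT_comp => //.
    apply: measurableT_comp => //; apply: measurable_funM => //.
    exact: (measurableT_comp (@measurable_sftl_rate R m)).
  apply/measurable_EFinP; apply: (measurableT_comp _ mc).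
  exact: measurable_indic.
apply: (eq_measurable_fun _ _ (measurable_duhamel ih (clamped_Pk_ge0 A k))) => p _.
rewrite -clamped_PkS; last exact: clamp_gaps_ge0.
by rewrite /clamped_Pk (clamp_gaps_id (clamp_gaps_ge0 p.2)).
Qed.

(** The event is reached after fewer than [K] jumps. The value is 0 at [K = 0], which makes the base
    case of each induction trivial. *)
Definition clamped_Psum A K (t : R) y := \sum_(0 <= k < K) clamped_Pk A k t y.

Definition clamped_P A (t : R) y := sftl_P t (clamp_gaps y) A.

Lemma clamped_PE A t y : clamped_P A t y = \sum_(0 <= k <oo) clamped_Pk A k t y.
Proof. by []. Qed.

Lemma sftl_P_clamped A t y : nonneg_gaps y -> sftl_P t y A = clamped_P A t y.
Proof. by move=> y0; rewrite /clamped_P clamp_gaps_id. Qed.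

Lemma clamped_Psum_ge0 A K t y : 0 <= clamped_Psum A K t y.
Proof. by apply: sume_ge0 => k _; exact: clamped_Pk_ge0. Qed.

Lemma clamped_P_ge0 A t y : 0 <= clamped_P A t y.
Proof. by apply: nneseries_ge0 => k _ _; exact: clamped_Pk_ge0. Qed.

Lemma clamped_Psum_le_P A K t y : clamped_Psum A K t y <= clamped_P A t y.
Proof. by apply: nneseries_lim_ge => k _ _; exact: clamped_Pk_ge0. Qed.

Lemma clamped_P_le A t y x :
  (forall K, clamped_Psum A K t y <= x) -> clamped_P A t y <= x.
Proof.
move=> h; apply: lime_le; last by apply: nearW.
by apply: is_cvg_nneseries => k _ _; exact: clamped_Pk_ge0.
Qed.

Lemma measurable_clamped_Psum A K : measurable A ->
  measurable_fun setT (fun p : R * T => clamped_Psum A K p.1 p.2).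
Proof. by move=> mA; apply: emeasurable_sum => k; exact: measurable_clamped_Pk. Qed.

Lemma measurable_clamped_P A : measurable A ->
  measurable_fun setT (fun p : R * T => clamped_P A p.1 p.2).
Proof.
move=> mA; apply: (eq_measurable_fun
  (fun p : R * T => \sum_(k <oo | k \in xpredT) clamped_Pk A k p.1 p.2)) => [p _|].
  exact: eq_eseriesl.
apply: ge0_emeasurable_sum => [k p _ _|k _]; first exact: clamped_Pk_ge0.
exact: measurable_clamped_Pk.
Qed.

(** Decomposition at the first jump, after which one jump less is available; this decrease of [K]
    drives the inductions. *)
Lemma clamped_Psum_rec A K t y : measurable A -> nonneg_gaps y ->
  clamped_Psum A K.+1 t y = (expR (- (sftl_rate y * t)) * \1_A y)%:E +
    \int[leb]_(s in `[0%R, t]%classic)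
    ((expR (- (sftl_rate y * s)))%:E * sftl_jump y (clamped_Psum A K (t - s)%R)).
Proof.
move=> mA y0; rewrite /clamped_Psum big_nat_recl//; congr (_ + _).
  by rewrite /clamped_Pk/= clamp_gaps_id.
under eq_bigr do rewrite clamped_PkS//.
rewrite -ge0_integral_sum//.
- apply: eq_integral => s _; rewrite sftl_jump_sum//.
  + by rewrite ge0_sume_distrr// => k _; apply: sftl_jump_ge0 => // z _; exact: clamped_Pk_ge0.
  + by move=> k; apply: (measurable_fun_pair2 (t - s)%R (measurable_clamped_Pk k mA)).
  + by move=> k z; exact: clamped_Pk_ge0.
- move=> k; apply: measurable_funTS; apply: emeasurable_funM; first exact: measurable_expRN_mul.
  by apply: measurable_sftl_jump_time; [exact: measurable_clamped_Pk|exact: clamped_Pk_ge0].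
- move=> k s _; rewrite mule_ge0 ?lee_fin ?expR_ge0//.
  by apply: sftl_jump_ge0 => // z _; exact: clamped_Pk_ge0.
Qed.

Lemma clamped_P_rec A t y : measurable A -> nonneg_gaps y ->
  clamped_P A t y = (expR (- (sftl_rate y * t)) * \1_A y)%:E +
    \int[leb]_(s in `[0%R, t]%classic)
    ((expR (- (sftl_rate y * s)))%:E * sftl_jump y (clamped_P A (t - s)%R)).
Proof.
move=> mA y0; rewrite clamped_PE (@nneseries_split _ _ 0 1) => [|k _]; last exact: clamped_Pk_ge0.
rewrite add0n big_nat1; congr (_ + _).
  by rewrite /clamped_Pk/= clamp_gaps_id.
rewrite -(@nneseries_addn _ (fun k => clamped_Pk A k t y) 1) => [|k]; last exact: clamped_Pk_ge0.
under eq_eseriesr do rewrite addn1 clamped_PkS//.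
rewrite -integral_nneseries//.
- apply: eq_integral => s _; rewrite sftl_jump_nneseries//.
  + by rewrite nneseriesZl// => k _; apply: sftl_jump_ge0 => // z _; exact: clamped_Pk_ge0.
  + by move=> k; apply: (measurable_fun_pair2 (t - s)%R (measurable_clamped_Pk k mA)).
  + by move=> k z; exact: clamped_Pk_ge0.
- move=> k; apply: measurable_funTS; apply: emeasurable_funM; first exact: measurable_expRN_mul.
  by apply: measurable_sftl_jump_time; [exact: measurable_clamped_Pk|exact: clamped_Pk_ge0].
- move=> k s _; rewrite mule_ge0 ?lee_fin ?expR_ge0//.
  by apply: sftl_jump_ge0 => // z _; exact: clamped_Pk_ge0.
Qed.

Lemma clamped_Pk_setC A k t y : measurable A -> nonneg_gaps y ->
  clamped_Pk A k t y + clamped_Pk (~` A) k t y = clamped_Pk setT k t y.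
Proof.
move=> mA; elim: k t y => [|k ih] t y y0.
  rewrite /clamped_Pk/= -ge0_muleDr ?lee_fin//; congr (_ * _).
  rewrite -EFinD indicC indicT; rewrite indicE; case: (_ \in _); rewrite /= ?addr0 ?add0r //.
have mAC := measurableC mA.
rewrite !clamped_PkS// -ge0_integralD//.
- apply: eq_integral => s _; rewrite -ge0_muleDr; last 2 first.
  + by apply: sftl_jump_ge0 => // z _; exact: clamped_Pk_ge0.
  + by apply: sftl_jump_ge0 => // z _; exact: clamped_Pk_ge0.
  congr (_ * _); rewrite -sftl_jumpD//.
  + by apply: eq_sftl_jump => // z z0; exact: ih.
  + exact: (measurable_fun_pair2 (t - s)%R (measurable_clamped_Pk k mA)).
  + exact: (measurable_fun_pair2 (t - s)%R (measurable_clamped_Pk k mAC)).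
  + by move=> z; exact: clamped_Pk_ge0.
  + by move=> z; exact: clamped_Pk_ge0.
- move=> s _; rewrite mule_ge0 ?lee_fin ?expR_ge0//.
  by apply: sftl_jump_ge0 => // z _; exact: clamped_Pk_ge0.
- apply: measurable_funTS; apply: emeasurable_funM; first exact: measurable_expRN_mul.
  by apply: measurable_sftl_jump_time; [exact: measurable_clamped_Pk|exact: clamped_Pk_ge0].
- move=> s _; rewrite mule_ge0 ?lee_fin ?expR_ge0//.
  by apply: sftl_jump_ge0 => // z _; exact: clamped_Pk_ge0.
- apply: measurable_funTS; apply: emeasurable_funM; first exact: measurable_expRN_mul.
  by apply: measurable_sftl_jump_time; [exact: measurable_clamped_Pk|exact: clamped_Pk_ge0].
Qed.

Lemma clamped_P_setC A t y : measurable A -> nonneg_gaps y ->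
  clamped_P A t y + clamped_P (~` A) t y = clamped_P setT t y.
Proof.
move=> mA y0; rewrite !clamped_PE -nneseriesD.
- by apply: eq_eseriesr => k _; exact: clamped_Pk_setC.
- by move=> k _ _; exact: clamped_Pk_ge0.
- by move=> k _ _; exact: clamped_Pk_ge0.
Qed.

(** For the extremal [G] the integral is computed exactly. The hypothesis at [r = t] already gives
    the sign of the constant, so none is imposed on [lam], which is negative in the coupling
    estimate. *)
Lemma exp_duhamel_le (a lam C t : R) (G : R -> \bar R) : (0 <= t)%R ->
  (forall r, (0 <= r <= t)%R -> 0 <= G r <= ((a + lam) * (C * expR (lam * r)))%:E) ->
  \int[leb]_(s in `[0%R, t]%classic) ((expR (- (a * s)))%:E * G (t - s)%R)
  <= (C * (expR (lam * t) - expR (- (a * t))))%:E.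
Proof.
move=> t0 hG.
have tt : (0 <= t <= t)%R by rewrite t0 lexx.
have C0 : (0 <= (a + lam) * (C * expR (lam * t)))%R.
  by have /andP[h1 h2] := hG t tt; rewrite -lee_fin (le_trans h1).
apply: (@le_trans _ _ (\int[leb]_(s in `[0%R, t]%classic)
   (((a + lam) * (C * expR (lam * t)))%:E * (expR (- ((a + lam) * s)))%:E))).
  apply: ge0_le_integral_nomeas => s /itv0t_bounds[s0 ts0];
    have /hG/andP[h1 h2] : (0 <= t - s <= t)%R by rewrite ts0 gerBl.
    by rewrite mule_ge0 ?lee_fin ?expR_ge0.
  apply: (le_trans (lee_wpmul2l _ h2)); first by rewrite lee_fin expR_ge0.
  rewrite -!EFinM lee_fin -!mulrA -expRD mulrCA le_eqVlt; apply/orP; left; apply/eqP; congr (_ * _)%R.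
  by rewrite mulrCA -expRD; congr (_ * expR _)%R; ring.
rewrite ge0_integralZl_EFin//; last by apply: measurable_funTS; exact: measurable_expRN_mul.
rewrite (mulrC (a + lam)%R) EFinM -muleA integral_itv0_expN// -EFinM lee_fin.
rewrite -mulrA mulrBr mulr1 -expRD le_eqVlt; apply/orP; left; apply/eqP; congr (_ * (_ - expR _))%R; ring.
Qed.

(** The generator is [sftl_jump] minus multiplication by the rate, so the drift hypothesis reads L W
    <= lam W. Then [expR (lam * t) * W] is a supersolution of the backward equation that dominates
    the indicator of [A] at time 0, and induction on [K] propagates this. *)
Lemma sftl_supersolution A (W : T -> R) (lam : R) : measurable A ->
  measurable_fun setT W -> (forall y, (0 <= W y)%R) ->
  (forall y, nonneg_gaps y -> A y -> (1 <= W y)%R) ->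
  (forall y, nonneg_gaps y ->
     sftl_jump y (fun z => (W z)%:E) <= ((sftl_rate y + lam) * W y)%:E) ->
  forall K t y, (0 <= t)%R -> nonneg_gaps y ->
  clamped_Psum A K t y <= (expR (lam * t) * W y)%:E.
Proof.
move=> mA mW W0 AW JW; have mW' : measurable_fun setT (fun z => (W z)%:E) by apply/measurable_EFinP.
elim => [|K ih] t y t0 y0.
  by rewrite /clamped_Psum big_nil lee_fin mulr_ge0 ?expR_ge0.
rewrite clamped_Psum_rec//.
rewrite (_ : (expR (lam * t) * W y)%R = (expR (- (sftl_rate y * t)) * W y +
  W y * (expR (lam * t) - expR (- (sftl_rate y * t))))%R); last by ring.
rewrite EFinD; apply: leeD.
  rewrite lee_fin ler_wpM2l ?expR_ge0// indicE.
  by case: (boolP (y \in A)) => [/set_mem|] yA //=; exact: AW.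
apply: (@exp_duhamel_le _ lam (W y) t (fun r => sftl_jump y (clamped_Psum A K r))) => // r /andP[r0 rt].
apply/andP; split; first by apply: sftl_jump_ge0 => // z _; exact: clamped_Psum_ge0.
apply: (@le_trans _ _ (sftl_jump y (fun z => (expR (lam * r))%:E * (W z)%:E))).
  by apply: le_sftl_jump => // z z0; rewrite clamped_Psum_ge0/= -EFinM ih.
rewrite sftl_jumpZ ?expR_ge0//.
apply: (le_trans (lee_wpmul2l _ (JW y y0))); first by rewrite lee_fin expR_ge0.
by rewrite -EFinM lee_fin mulrCA (mulrC (W y)).
Qed.

Lemma clamped_P_le1 A t y : measurable A -> (0 <= t)%R -> nonneg_gaps y ->
  clamped_P A t y <= 1.
Proof.
move=> mA t0 y0; apply: clamped_P_le => K.
have := @sftl_supersolution A (fun=> 1%R) 0%R mA _ _ _ _ K t y t0 y0.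
rewrite mul0r expR0 mul1r; apply => // z z0.
by rewrite sftl_jump_cst// addr0.
Qed.

End transition_function.

(** * Non-explosion *)

Section drift_estimates.
Local Open Scope ereal_scope.
Variables (R : realType).
Notation leb := (@lebesgue_measure R).

Lemma le_expR_half (x : R) : (0 <= x)%R -> (x <= expR (x / 2))%R.
Proof.
move=> x0; have -> : (x / 2 = x / 4 + x / 4)%R by field.
rewrite expRD; have h := expR_ge1Dx (x / 4)%R.
have h0 : (0 <= 1 + x / 4)%R by rewrite addr_ge0// divr_ge0.
apply: (@le_trans _ _ ((1 + x / 4) * (1 + x / 4))%R); last by apply: ler_pM.
rewrite -subr_ge0 (_ : _ - _ = (1 - x / 4) ^+ 2)%R; [exact: sqr_ge0|by field].
Qed.

(** Bounding [e] by [expR (e / 2)] reduces everything to exponentials and costs a factor 2 over the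
    true mean 1. Negative [k] above -1 is allowed and serves the growing test functions of the lower
    bound. *)
Lemma leader_integral_le (a b c k : R) (g : R -> \bar R) :
  (0 <= a)%R -> (0 <= b)%R -> (0 <= c)%R -> (0 < 1 + k)%R ->
  (forall e, (0 <= e)%R -> 0 <= g e <= (a + b * e + c * expR (- (k * e)))%:E) ->
  \int[leb]_(e in `[0%R, +oo[%classic) ((expR (- e))%:E * g e)
  <= (a + 2 * b + c / (1 + k))%:E.
Proof.
move=> a0 b0 c0 k1 hg.
have mexp (l : R) : measurable_fun (`[0%R, +oo[%classic : set R) (fun s : R => (expR (- (l * s)))%:E).
  by apply: measurable_funTS; exact: measurable_expRN_mul.
have mcexp (d l : R) : measurable_fun (`[0%R, +oo[%classic : set R) (fun s : R => d%:E * (expR (- (l * s)))%:E).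
  exact: measurable_funeM.
apply: (@le_trans _ _ (\int[leb]_(e in `[0%R, +oo[%classic)
   (a%:E * (expR (- (1 * e)))%:E + (b%:E * (expR (- (2^-1 * e)))%:E +
    c%:E * (expR (- ((1 + k) * e)))%:E)))).
  apply: ge0_le_integral_nomeas => e /itv0y_ge0 e0; have /andP[g0 g1] := hg e e0.
    by rewrite mule_ge0 ?lee_fin ?expR_ge0.
  apply: (le_trans (lee_wpmul2l _ g1)); first by rewrite lee_fin expR_ge0.
  rewrite -!EFinM -!EFinD lee_fin mul1r !mulrDr addrA.
  rewrite lerD//; last first.
    by rewrite mulrCA -expRD mulrDl mul1r opprD.
  rewrite lerD//; first by rewrite mulrC.
  rewrite mulrCA ler_wpM2l//.
  have -> : (- (2^-1 * e) = - e + e / 2)%R by field.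
  by rewrite expRD ler_wpM2l ?expR_ge0// le_expR_half.
rewrite ge0_integralD//=; last 4 first.
- by move=> e _; rewrite mule_ge0 ?lee_fin ?expR_ge0.
- exact: mcexp.
- by move=> e _; rewrite adde_ge0 ?mule_ge0 ?lee_fin ?expR_ge0.
- by apply: emeasurable_funD; exact: mcexp.
rewrite ge0_integralD//=; last 4 first.
- by move=> e _; rewrite mule_ge0 ?lee_fin ?expR_ge0.
- exact: mcexp.
- by move=> e _; rewrite mule_ge0 ?lee_fin ?expR_ge0.
- exact: mcexp.
have E (d l : R) : (0 <= d)%R -> (0 < l)%R ->
    \int[leb]_(e in `[0%R, +oo[%classic) (d%:E * (expR (- (l * e)))%:E) = (d / l)%:E.
  move=> d0 l0; rewrite ge0_integralZl_EFin//; last exact: mexp.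
    by rewrite EFinM; congr (_ * _); exact: integral_itv0y_expN.
by rewrite !E// ?invr_gt0// invr1 mulr1 invrK -!EFinD (mulrC b) addrA.
Qed.

Lemma integral_itv01_affine (a b : R) : (0 <= b)%R -> (b <= a)%R ->
  \int[leb]_(u in `[0%R, 1%R]%classic) (a - b * u)%:E = (a - b / 2)%:E.
Proof.
move=> b0 ba.
have m1 : measurable_fun (`[0%R, 1%R]%classic : set R) (fun u : R => (1 - u)%:E).
  by apply: measurable_funTS; apply/measurable_EFinP; apply: measurable_funB.
transitivity (\int[leb]_(u in `[0%R, 1%R]%classic) ((a - b)%:E + b%:E * (1 - u)%:E)).
  apply: eq_integral => u _; rewrite -EFinM -EFinD; congr EFin; ring.
rewrite ge0_integralD//; last 3 first.
- by move=> u _; rewrite lee_fin subr_ge0.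
- by move=> u /itv01_01/andP[u0 u1]; rewrite mule_ge0 ?lee_fin ?subr_ge0.
- exact: measurable_funeM.
rewrite integral_itv01_cst ge0_integralZl_EFin//; last first.
  by move=> u /itv01_01/andP[u0 u1]; rewrite lee_fin subr_ge0.
by rewrite integral_itv01_onem -EFinM -EFinD; congr EFin; field.
Qed.

Variable m : nat.
Notation T := (m.-tuple R).
Implicit Types (y z : T).

Lemma sum_leader_jump_le y (e : R) : (0 <= e)%R ->
  (\sum_(i < m) tnth (leader_jump y e) i <= \sum_(i < m) tnth y i + e)%R.
Proof.
move=> e0; case: m y => [|m'] y; first by rewrite !big_ord0 add0r.
rewrite !big_ord_recl/= tnth_mktuple/= [leRHS]addrAC lerD2l.
by apply: ler_sum => i _; rewrite tnth_mktuple.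
Qed.

Lemma tnth_follower_jump y (j : 'I_m) (u : R) i :
  tnth (follower_jump y j u) i =
  (tnth y i - (if i == j then u * tnth y j else 0)
   + (if (i : nat) == j.+1 then u * tnth y j else 0))%R.
Proof.
rewrite tnth_mktuple; case: eqP => [->|_]; first by rewrite ltn_eqF// addr0.
by rewrite subr0; case: ifP => _; rewrite ?addr0.
Qed.

(** The jump carries the mass [u * tnth y j] from gap j to gap j+1. The inner sum has one term, or
    none if j is the last gap, where the mass leaves the system; one formula covers both cases. *)
Lemma sum_follower_jump (c : 'I_m -> R) y (j : 'I_m) (u : R) :
  (\sum_(i < m) c i * tnth (follower_jump y j u) i =
   \sum_(i < m) c i * tnth y i
   - u * tnth y j * (c j - \sum_(i < m | i == j.+1 :> nat) c i))%R.
Proof.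
under eq_bigr do rewrite tnth_follower_jump mulrDr mulrBr.
rewrite big_split/= sumrB -addrA; congr (_ + _)%R.
rewrite mulrBr opprB addrC; congr (_ - _)%R.
  rewrite mulr_sumr [RHS]big_mkcond/=; apply: eq_bigr => i _.
  by case: ifP => _; rewrite ?mulr0// mulrC.
rewrite (bigD1 j)//= eqxx big1 ?addr0 1?mulrC// => i /negbTE ->.
by rewrite mulr0.
Qed.

Lemma sum_follower_jump_le y (j : 'I_m) (u : R) : nonneg_gaps y -> (0 <= u)%R ->
  (\sum_(i < m) tnth (follower_jump y j u) i <= \sum_(i < m) tnth y i)%R.
Proof.
move=> y0 u0; have := sum_follower_jump (fun=> 1%R) y j u.
under eq_bigr do rewrite mul1r.
move=> ->; under eq_bigr do rewrite mul1r.
rewrite gerBl mulr_ge0 ?mulr_ge0// subr_ge0.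
have [jm|jm] := ltnP j.+1 m.
  rewrite (big_pred1 (Ordinal jm))// => i /=.
rewrite big1// => i /eqP ij.
by have := ltn_ord i; rewrite ij ltnNge jm.
Qed.

(** Followers never increase the total gap, so only the leader contributes, at most 2. What remains
    is q + 2 + (q - 1) q <= (q + 2) q, true because q >= 1. *)
Lemma sftl_rate_drift y : nonneg_gaps y ->
  sftl_jump y (fun z => (sftl_rate z)%:E) <= ((sftl_rate y + 2) * sftl_rate y)%:E.
Proof.
move=> y0; have q1 : (1 <= sftl_rate y)%R by rewrite lerDl sumr_ge0.
have q0 : (0 <= sftl_rate y)%R by apply: le_trans q1.
apply: (@le_trans _ _ ((sftl_rate y + 2 * 1 + 0 / (1 + 0))%:E +
   \sum_(j < m) ((tnth y j)%:E * (sftl_rate y)%:E))).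
  apply: leeD.
    apply: leader_integral_le => [//|//|//||e e0]; first by rewrite addr0.
    rewrite !lee_fin sftl_rate_ge0/=; last exact: leader_jump_ge0.
    by rewrite mul0r addr0 mul1r /sftl_rate -addrA lerD2l sum_leader_jump_le.
  apply: lee_sum => j _; apply: lee_wpmul2l; first by rewrite lee_fin.
  rewrite -[leRHS]integral_itv01_cst; apply: ge0_le_integral_nomeas => u u01.
    by rewrite lee_fin sftl_rate_ge0//; apply: follower_jump_ge0 => //; exact: itv01_01.
  by rewrite lee_fin lerD2l sum_follower_jump_le//; case/andP: (itv01_01 u01).
under eq_bigr do rewrite -EFinM.
rewrite sumEFin -mulr_suml -EFinD lee_fin mul0r addr0.
have -> : (\sum_(i < m) tnth y i = sftl_rate y - 1)%R by rewrite /sftl_rate; ring.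
rewrite -subr_ge0 (_ : _ - _ = 2 * (sftl_rate y - 1))%R; last by ring.
by rewrite mulr_ge0 ?subr_ge0.
Qed.

(* The expected number of jumps before time t is at most the rate times exp(3t): this is
   what rules out explosion. *)
Lemma clamped_Psum_count N (t : R) y : (0 <= t)%R -> nonneg_gaps y ->
  N%:R%:E <= \sum_(0 <= K < N) clamped_Psum setT K.+1 t y
             + (sftl_rate y * expR (3 * t))%:E.
Proof.
have mS K : measurable_fun setT (fun p : R * T =>
    \sum_(0 <= k < K) clamped_Psum setT k.+1 p.1 p.2).
  by apply: emeasurable_sum => k; exact: measurable_clamped_Psum.
have S0 K (t' : R) (z : T) : 0 <= \sum_(0 <= k < K) clamped_Psum setT k.+1 t' z.
  by apply: sume_ge0 => k _; exact: clamped_Psum_ge0.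
(* If J is the number of jumps before t, the sum of P(J <= K) over K < N is N - E min(J, N); the
   claim is thus a bound on E min(J, N) uniform in N. *)
elim: N t y => [|N ih] t y t0 y0.
  by rewrite adde_ge0// lee_fin mulr_ge0 ?expR_ge0 ?sftl_rate_ge0.
set q := sftl_rate y; have q0 : (0 <= q)%R by exact: sftl_rate_ge0.
pose G r := sftl_jump y (fun z => \sum_(0 <= k < N) clamped_Psum setT k.+1 r z).
have mG : measurable_fun setT (fun s : R => G (t - s)%R).
  exact: (@measurable_sftl_jump_time R m
    (fun r z => \sum_(0 <= k < N) clamped_Psum setT k.+1 r z) (mS N) (S0 N)).
have G0 r : 0 <= G r by apply: sftl_jump_ge0.
have mEG : measurable_fun setT (fun s : R => (expR (- (q * s)))%:E * G (t - s)%R).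
  by apply: emeasurable_funM => //; exact: measurable_expRN_mul.
have mEE : measurable_fun setT (fun s : R => (expR (- (q * s)))%:E *
    ((q + 3) * (q * expR (3 * (t - s))))%:E).
  apply: emeasurable_funM; first exact: measurable_expRN_mul.
  apply/measurable_EFinP; apply: measurable_funM => //; apply: measurable_funM => //.
  by apply: measurableT_comp => //; apply: measurable_funM => //; exact: measurable_funB.
have -> : \sum_(0 <= K < N.+1) clamped_Psum setT K.+1 t y =
    (N.+1%:R * expR (- (q * t)))%:E +
    \int[leb]_(s in `[0%R, t]%classic) ((expR (- (q * s)))%:E * G (t - s)%R).
  under eq_bigr do rewrite clamped_Psum_rec// indicT mulr1.
  rewrite big_split/=; congr (_ + _).
    by rewrite sumEFin sumr_const_nat subn0 mulr_natl.
  rewrite -ge0_integral_sum//; last 2 first.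
  - move=> K; apply: measurable_funTS; apply: emeasurable_funM; first exact: measurable_expRN_mul.
    by apply: measurable_sftl_jump_time; [exact: measurable_clamped_Psum|exact: clamped_Psum_ge0].
  - move=> K s _; rewrite mule_ge0 ?lee_fin ?expR_ge0//.
    by apply: sftl_jump_ge0 => // z _; exact: clamped_Psum_ge0.
  apply: eq_integral => s _.
  rewrite -ge0_sume_distrr => [|K _]; last first.
    by apply: sftl_jump_ge0 => // z _; exact: clamped_Psum_ge0.
  congr (_ * _); rewrite -sftl_jump_sum//; last 2 first.
  - by move=> K; apply: (measurable_fun_pair2 (t - s)%R (measurable_clamped_Psum K _)).
  - by move=> K z; exact: clamped_Psum_ge0.
  apply: eq_sftl_jump => // z z0; rewrite big_nat_recl//.
  by rewrite {1}/clamped_Psum big_nil add0e.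
(* The drift of the rate accounts for [q + 2]; the third unit pays for counting the present jump,
   which raises N to N + 1. *)
have hint : \int[leb]_(s in `[0%R, t]%classic) ((expR (- (q * s)))%:E * (N.+1%:R * q)%:E)
  <= \int[leb]_(s in `[0%R, t]%classic) ((expR (- (q * s)))%:E * G (t - s)%R)
     + (q * expR (3 * t))%:E.
  apply: (@le_trans _ _ (\int[leb]_(s in `[0%R, t]%classic)
     ((expR (- (q * s)))%:E * G (t - s)%R +
      (expR (- (q * s)))%:E * ((q + 3) * (q * expR (3 * (t - s))))%:E))).
    apply: ge0_le_integral_nomeas => s /itv0t_bounds[s0 ts0].
      by rewrite mule_ge0 ?lee_fin ?expR_ge0// mulr_ge0.
    have C0 : (0 <= (q + 3) * (q * expR (3 * (t - s))))%R.
      by apply: mulr_ge0; [exact: addr_ge0|apply: mulr_ge0 => //; exact: expR_ge0].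
    rewrite -ge0_muleDr ?lee_fin//.
    apply: lee_wpmul2l; first by rewrite lee_fin expR_ge0.
    have h1 : (N%:R * q)%:E <= G (t - s)%R + ((q + 2) * (q * expR (3 * (t - s))))%:E.
      apply: (@le_trans _ _ (sftl_jump y (fun z =>
        \sum_(0 <= k < N) clamped_Psum setT k.+1 (t - s) z +
        (expR (3 * (t - s)))%:E * (sftl_rate z)%:E))).
        rewrite mulrC -sftl_jump_cst//; apply: le_sftl_jump => // z z0.
        by rewrite lee_fin ler0n/= -EFinM (mulrC (expR _)) ih.
      have mq : measurable_fun setT (fun z : T => (sftl_rate z)%:E).
        by apply/measurable_EFinP; exact: measurable_sftl_rate.
      pose cq (z : T) := sftl_rate (clamp_gaps z).
      have mcq : measurable_fun setT (fun z : T => (cq z)%:E).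
        apply/measurable_EFinP; apply: (measurableT_comp (@measurable_sftl_rate R m)).
        exact: measurable_clamp_gaps.
      have cq0 z : (0 <= cq z)%R by apply: sftl_rate_ge0; exact: clamp_gaps_ge0.
      rewrite (@eq_sftl_jump _ _ y _ (fun z =>
        \sum_(0 <= k < N) clamped_Psum setT k.+1 (t - s) z +
        (expR (3 * (t - s)))%:E * (cq z)%:E)) => [|//|z z0]; last first.
        by rewrite /cq clamp_gaps_id.
      rewrite sftl_jumpD//; last 3 first.
      - exact: (measurable_fun_pair2 (t - s)%R (mS N)).
      - exact: measurable_funeM.
      - by move=> z; rewrite mule_ge0 ?lee_fin ?expR_ge0.
      rewrite leeD2l// sftl_jumpZ ?expR_ge0//.
      rewrite (_ : ((q + 2) * _)%:E = (expR (3 * (t - s)))%:E * ((q + 2) * q)%:E); last first.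
        by rewrite -EFinM; congr EFin; ring.
      apply: lee_wpmul2l; first by rewrite lee_fin expR_ge0.
      rewrite (@eq_sftl_jump _ _ y _ (fun z => (sftl_rate z)%:E)) => [|//|z z0]; last first.
        by rewrite /cq clamp_gaps_id.
      exact: sftl_rate_drift.
    have -> : (N.+1%:R * q)%:E = (N%:R * q)%:E + q%:E.
      by rewrite -EFinD -natr1; congr EFin; ring.
    have -> : ((q + 3) * (q * expR (3 * (t - s))) =
       (q + 2) * (q * expR (3 * (t - s))) + q * expR (3 * (t - s)))%R by ring.
    rewrite (EFinD ((q + 2) * _)) addeA; apply: leeD; first exact: h1.
    by rewrite lee_fin ler_peMr// -expR0 ler_expR mulr_ge0.
  rewrite ge0_integralD//; last 4 first.
  - by move=> s _; rewrite mule_ge0 ?lee_fin ?expR_ge0.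
  - exact: measurable_funTS.
  - move=> s _; rewrite mule_ge0 ?lee_fin ?expR_ge0//.
    by apply: mulr_ge0; [exact: addr_ge0|apply: mulr_ge0 => //; exact: expR_ge0].
  - exact: measurable_funTS.
  rewrite leeD2l//.
  apply: (le_trans (@exp_duhamel_le R q 3%R q t (fun r => ((q + 3) * (q * expR (3 * r)))%:E) t0 _)).
    move=> r _; rewrite lexx andbT lee_fin.
    by apply: mulr_ge0; [exact: addr_ge0|apply: mulr_ge0 => //; exact: expR_ge0].
  by rewrite lee_fin ler_wpM2l// gerBl expR_ge0.
(* The constant N + 1 is split by the same first-jump decomposition, into weights [expR (- (q * t))]
   and its complement to 1, to be compared term by term. *)
have -> : N.+1%:R%:E = (N.+1%:R * expR (- (q * t)))%:E +
  \int[leb]_(s in `[0%R, t]%classic) ((expR (- (q * s)))%:E * (N.+1%:R * q)%:E).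
  under eq_integral do rewrite muleC.
  rewrite ge0_integralZl_EFin ?mulr_ge0//; last first.
    by apply: measurable_funTS; exact: measurable_expRN_mul.
  rewrite (EFinM _ q) -muleA integral_itv0_expN// -EFinM -EFinD; congr EFin; ring.
by rewrite -addeA leeD2l.
Qed.

Lemma clamped_P_setT (t : R) y : (0 <= t)%R -> nonneg_gaps y ->
  clamped_P setT t y = 1.
Proof.
move=> t0 y0; apply/eqP; rewrite eq_le clamped_P_le1//=.
have p0 := clamped_P_ge0 setT t y.
have p1 := clamped_P_le1 measurableT t0 y0.
have pfin : clamped_P setT t y \is a fin_num.
  by rewrite ge0_fin_numE// (le_lt_trans p1) ?ltry.
rewrite -(fineK pfin) lee_fin leNgt; apply/negP => plt.
set p := fine _ in plt.
set C := (sftl_rate y * expR (3 * t))%R.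
have d0 : (0 < 1 - p)%R by rewrite subr_gt0.
(* If the total mass [p] were below 1, every truncated mass would be at most [p], and the count
   would give N (1 - p) <= C for all N; this N violates it. *)
pose N := (Num.bound (C / (1 - p))).
have hN : (C / (1 - p) < N%:R)%R.
  apply: archi_boundP; apply: divr_ge0; last exact: ltW.
  by rewrite mulr_ge0 ?expR_ge0 ?sftl_rate_ge0.
have := clamped_Psum_count N t0 y0.
apply/negP; rewrite -ltNge.
apply: (@le_lt_trans _ _ ((N%:R * p)%:E + C%:E)).
  rewrite leeD2r// EFinM fineK// muleC.
  apply: (@le_trans _ _ (\sum_(0 <= K < N) clamped_P setT t y)).
    by apply: lee_sum => K _; exact: clamped_Psum_le_P.
  by rewrite -{1}(fineK pfin) sumEFin sumr_const_nat subn0 -(fineK pfin) -EFinM mulr_natr.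
rewrite -EFinD lte_fin -ltrBrDl -[X in (_ < X - _)%R]mulr1 -mulrBr.
by rewrite -ltr_pdivrMr.
Qed.

End drift_estimates.

(** * Uniformization and the coupled configurations *)

Section uniformization.
Local Open Scope ereal_scope.
Variables (R : realType).
Notation leb := (@lebesgue_measure R).

(* Phantom jumps at rate Q - q do not change the solution of the backward equation. *)
Lemma duhamel_uniformization (g u : R -> \bar R) (a q Q t : R) :
  measurable_fun setT g -> (forall r, 0 <= g r) -> (0 <= a)%R -> (q <= Q)%R ->
  (0 <= t)%R ->
  (forall r, (0 <= r)%R -> u r = (expR (- (q * r)) * a)%:E +
     \int[leb]_(s in `[0%R, r]%classic) ((expR (- (q * s)))%:E * g (r - s)%R)) ->
  \int[leb]_(s in `[0%R, t]%classic)
      ((expR (- (Q * s)))%:E * (g (t - s)%R + (Q - q)%:E * u (t - s)%R))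
  <= u t.
Proof.
move=> mg g0 a0 qQ t0 hu; set c := (Q - q)%R.
have c0 : (0 <= c)%R by rewrite subr_ge0.
have mgt : measurable_fun setT (fun s : R => g (t - s)%R).
  by apply: (measurableT_comp mg); exact: measurable_funB.
pose E : set (R * R) := [set p | (0 <= p.1)%R] `&` [set p | (p.1 <= p.2)%R] `&` [set p | (p.2 <= t)%R].
have mE : measurable E.
  apply: measurableI; first apply: measurableI; rewrite -[X in measurable X]setTI.
  - by apply: (measurable_fun_le (f := fun=> 0%R) (g := fst)).
  - by apply: (measurable_fun_le (f := fst) (g := snd)).
  - by apply: (measurable_fun_le (f := snd) (g := fun=> t)).
pose H (p : R * R) := (c * expR (- (q * p.2)) * expR (- (c * p.1)))%:E * g (t - p.2)%R.
have H0 p : 0 <= H p by rewrite mule_ge0// lee_fin !mulr_ge0 ?expR_ge0.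
have mH : measurable_fun setT H.
  apply: emeasurable_funM; last exact: (measurableT_comp mgt measurable_snd).
  apply/measurable_EFinP; apply: measurable_funM.
    by apply: measurable_funM => //; apply: measurableT_comp => //;
      apply: measurableT_comp => //; apply: measurable_funM.
  by apply: measurableT_comp => //; apply: measurableT_comp => //; apply: measurable_funM.
have mHE : measurable_fun setT (H \_ E).
  by have := (measurable_restrictT H mE).1 (measurable_funTS mH).
have HE0 p : 0 <= (H \_ E) p by apply: erestrict_ge0 => // x _.
have mid : measurable_fun setT (fubini_F leb (H \_ E)).
  exact: measurable_fun_fubini_tonelli_F.
have mQg : measurable_fun setT (fun s : R => (expR (- (Q * s)))%:E * g (t - s)%R).
  by apply: emeasurable_funM => //; exact: measurable_expRN_mul.
(* The equation for [u (t - s)] is substituted, and its inner time is shifted by [s], so that the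
   phantom term becomes an integral over [s <= r <= t]. *)
have step1 s : `[0%R, t]%classic s ->
    (expR (- (Q * s)))%:E * (g (t - s)%R + c%:E * u (t - s)%R) =
    (expR (- (Q * s)))%:E * g (t - s)%R +
    ((a * expR (- (q * t)))%:E * (c%:E * (expR (- (c * s)))%:E) + \int[leb]_r (H \_ E) (s, r)).
  move=> /itv0t_bounds[s0 ts0].
  have int0 : 0 <= \int[leb]_(x in `[0%R, (t - s)%R]%classic) ((expR (- (q * x)))%:E * g (t - s - x)%R).
    by apply: integral_ge0 => x _; rewrite mule_ge0 ?lee_fin ?expR_ge0.
  rewrite hu// ge0_muleDr//; last first.
    by rewrite mule_ge0 ?lee_fin// adde_ge0// lee_fin mulr_ge0 ?expR_ge0.
  congr (_ + _); rewrite ge0_muleDr//; last by rewrite lee_fin mulr_ge0 ?expR_ge0.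
  rewrite ge0_muleDr//; last 2 first.
  - by rewrite -EFinM lee_fin !mulr_ge0 ?expR_ge0.
  - by rewrite mule_ge0 ?lee_fin.
  congr (_ + _).
    rewrite -!EFinM; congr EFin.
    have -> : (- (q * t) = - (q * (t - s)) + - (q * s))%R by ring.
    have -> : (- (Q * s) = - (c * s) + - (q * s))%R by rewrite /c; ring.
    rewrite !expRD; ring.
  have -> : \int[leb]_r (H \_ E) (s, r) = \int[leb]_(r in `[s, t]%classic) H (s, r).
    rewrite [RHS]integral_mkcond; apply: eq_integral => r _; rewrite !patchE.
    have -> // : ((s, r) \in E) = (r \in `[s, t]%classic).
    apply/idP/idP => /set_mem; rewrite /E/= ?in_itv/=.
      by move=> [[_ sr] rt]; apply/mem_set; rewrite /= in_itv/= sr.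
    by move=> /andP[sr rt]; apply/mem_set; split.
  rewrite (@ge0_integral_affine R 1%R s _ (fun r => H (s, r)) ltr01 (measurable_itv _)
    (measurable_funTS (measurable_fun_pair2 s mH)) (fun r _ => H0 (s, r))).
  have -> : (fun x : R => (1 * x + s)%R) @^-1` `[s, t]%classic = `[0%R, (t - s)%R]%classic.
    by apply/seteqP; split => x /=; rewrite !in_itv/= mul1r lerDr lerBrDr.
  rewrite mul1e muleA -EFinM -ge0_integralZl_EFin//.
  - apply: eq_integral => x _; rewrite /H/= muleA -EFinM; congr (_%:E * g _); last by ring.
    have -> : (- (Q * s) = - (c * s) + - (q * s))%R by rewrite /c; ring.
    have -> : (- (q * (1 * x + s)) = - (q * x) + - (q * s))%R by ring.
    rewrite !expRD; ring.
  - by move=> x _; rewrite mule_ge0 ?lee_fin ?expR_ge0.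
  - apply: measurable_funTS; apply: emeasurable_funM; first exact: measurable_expRN_mul.
    apply: (measurableT_comp mg); exact: measurable_funB.
  - by rewrite mulr_ge0 ?expR_ge0.
(* By Tonelli the phantom time [s] is integrated first over [[0, r]], giving 1 - exp(-c r). Together
   with the weight exp(-Q r) = exp(-q r) exp(-c r) of the direct term this restores exp(-q r). *)
have step2 : \int[leb]_(s in `[0%R, t]%classic) \int[leb]_r (H \_ E) (s, r) <=
    \int[leb]_(r in `[0%R, t]%classic) ((expR (- (q * r)) * (1 - expR (- (c * r))))%:E * g (t - r)%R).
  apply: (@le_trans _ _ (\int[leb]_s \int[leb]_r (H \_ E) (s, r))).
    by apply: ge0_subset_integral => // s _; apply: integral_ge0.
  rewrite (@fubini_tonelli _ _ _ _ R leb leb (H \_ E) mHE HE0) [leRHS]integral_mkcond.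
  apply: ge0_le_integral_nomeas => r _; first exact: integral_ge0.
  rewrite patchE; case: ifPn => [/set_mem|] rt; last first.
    rewrite integral0_eq// => s _; rewrite patchE; case: ifPn => // /set_mem [[s0 sr] rt'].
    move/negP: rt; case; apply/mem_set; rewrite /= in_itv/= rt' andbT.
    exact: le_trans sr.
  have [r0 rt'] := itv0t_bounds rt.
  have -> : \int[leb]_s (H \_ E) (s, r) = \int[leb]_(s in `[0%R, r]%classic) H (s, r).
    rewrite [RHS]integral_mkcond; apply: eq_integral => s _; rewrite !patchE.
    have -> // : ((s, r) \in E) = (s \in `[0%R, r]%classic).
    apply/idP/idP => /set_mem; rewrite /E/= ?in_itv/=.
      by move=> [[s0 sr] _]; apply/mem_set; rewrite /= in_itv/= s0.
    move=> /andP[s0 sr]; apply/mem_set; split; first by split.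
    by rewrite /= -subr_ge0.
  have -> : \int[leb]_(s in `[0%R, r]%classic) H (s, r) =
    \int[leb]_(s in `[0%R, r]%classic) (((expR (- (q * r)))%:E * g (t - r)%R) *
      (c%:E * (expR (- (c * s)))%:E)).
    apply: eq_integral => s _; rewrite /H/= muleAC -!EFinM; congr (_%:E * _); ring.
  rewrite ge0_integralZl//; last 3 first.
  - by apply: measurable_funTS; apply: measurable_funeM; exact: measurable_expRN_mul.
  - by move=> s _; rewrite mule_ge0 ?lee_fin ?expR_ge0.
  - by rewrite mule_ge0 ?lee_fin ?expR_ge0.
  rewrite ge0_integralZl_EFin//; last first.
    by apply: measurable_funTS; exact: measurable_expRN_mul.
  by rewrite integral_itv0_expN// muleAC -EFinM.
have mB : measurable_fun setT (fun s : R => (a * expR (- (q * t)))%:E * (c%:E * (expR (- (c * s)))%:E)).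
  apply: measurable_funeM; apply: measurable_funeM; exact: measurable_expRN_mul.
have mN : measurable_fun setT (fun r : R =>
    (expR (- (q * r)) * (1 - expR (- (c * r))))%:E * g (t - r)%R).
  apply: emeasurable_funM => //; apply/measurable_EFinP; apply: measurable_funM.
    by apply/measurable_EFinP; exact: measurable_expRN_mul.
  by apply: measurable_funB => //; apply/measurable_EFinP; exact: measurable_expRN_mul.
have -> : \int[leb]_(s in `[0%R, t]%classic)
      ((expR (- (Q * s)))%:E * (g (t - s)%R + c%:E * u (t - s)%R)) =
  \int[leb]_(s in `[0%R, t]%classic) ((expR (- (Q * s)))%:E * g (t - s)%R +
    ((a * expR (- (q * t)))%:E * (c%:E * (expR (- (c * s)))%:E) + \int[leb]_r (H \_ E) (s, r))).
  by apply: eq_integral => s /set_mem; exact: step1.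
rewrite ge0_integralD//; last 4 first.
- by move=> s _; rewrite mule_ge0 ?lee_fin ?expR_ge0.
- exact: measurable_funTS.
- move=> s _; rewrite adde_ge0 ?integral_ge0// !mule_ge0 ?lee_fin ?expR_ge0//.
  by rewrite mulr_ge0 ?expR_ge0.
- by apply: measurable_funTS; apply: emeasurable_funD.
rewrite ge0_integralD//; last 4 first.
- move=> s _; rewrite !mule_ge0 ?lee_fin ?expR_ge0//.
  by rewrite mulr_ge0 ?expR_ge0.
- exact: measurable_funTS.
- by move=> s _; exact: integral_ge0.
- exact: measurable_funTS.
(* The initial value returns with weight exp(-q t) (1 - exp(-c t)). The missing part, exp(-Q t) [a],
   corresponds to no jump at all, phantom or real; dropping it leaves an inequality. *)
rewrite addeCA hu//; apply: leeD.
  rewrite ge0_integralZl_EFin//; last 3 first.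
  - by move=> s _; rewrite mule_ge0 ?lee_fin ?expR_ge0.
  - by apply: measurable_funTS; apply: measurable_funeM; exact: measurable_expRN_mul.
  - by rewrite mulr_ge0 ?expR_ge0.
  rewrite ge0_integralZl_EFin//; last first.
    by apply: measurable_funTS; exact: measurable_expRN_mul.
  rewrite integral_itv0_expN// -EFinM lee_fin (mulrC a) ler_piMr//.
    by rewrite mulr_ge0 ?expR_ge0.
apply: (le_trans (leeD2l _ step2)).
rewrite -ge0_integralD//; last 4 first.
- by move=> s _; rewrite mule_ge0 ?lee_fin ?expR_ge0.
- exact: measurable_funTS.
- move=> s /itv0t_bounds[s0 _]; rewrite mule_ge0 ?lee_fin// mulr_ge0 ?expR_ge0//.
  by rewrite subr_ge0 -expR0 ler_expR oppr_le0 mulr_ge0.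
- exact: measurable_funTS.
apply: ge0_le_integral_nomeas => s /itv0t_bounds[s0 _].
  rewrite adde_ge0// mule_ge0 ?lee_fin ?expR_ge0// mulr_ge0 ?expR_ge0//.
  by rewrite subr_ge0 -expR0 ler_expR oppr_le0 mulr_ge0.
have e0 : (0 <= expR (- (q * s)) * (1 - expR (- (c * s))))%R.
  rewrite mulr_ge0 ?expR_ge0// subr_ge0 -expR0 ler_expR oppr_le0 mulr_ge0//.
rewrite -ge0_muleDl ?lee_fin ?expR_ge0// -EFinD.
have -> : (- (Q * s) = - (q * s) + - (c * s))%R by rewrite /c; ring.
by rewrite expRD mulrBr mulr1 subrKC.
Qed.
End uniformization.

(** * Coupled pairs of configurations and their behaviour under single jumps *)

Section coupling.
Local Open Scope ereal_scope.
Variables (R : realType) (m : nat).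
Notation leb := (@lebesgue_measure R).
Notation T := (m.-tuple R).
Implicit Types (y z : T) (k j : 'I_m).

(** With [c] the ratio of the smaller to the larger gap, the first piece holds the jumps whose
    target lies behind the other copy, and the second, rescaled, is a uniform jump inside the common
    part of the gaps. *)
Lemma ge0_integral_itv01_split (c : R) (f : R -> \bar R) :
  (0 < c <= 1)%R -> measurable_fun setT f -> (forall u, 0 <= f u) ->
  \int[leb]_(u in `[0%R, 1%R]%classic) f u =
  \int[leb]_(u in `[0%R, (1 - c)%R[%classic) f u +
  c%:E * \int[leb]_(u in `[0%R, 1%R]%classic) f (c * u + (1 - c))%R.
Proof.
move=> /andP[c0 c1] mf f0.
have -> : \int[leb]_(u in `[0%R, 1%R]%classic) f u =
   \int[leb]_(u in `[0%R, (1 - c)%R[%classic `|` `[(1 - c)%R, 1%R]%classic) f u.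
  congr (integral _ _ _); apply/seteqP; split => u /=; rewrite !in_itv/=.
    by move=> /andP[u0 u1]; case: (ltP u (1 - c)%R) => h; [left|right]; apply/andP.
  move=> [/andP[u0 u1]|/andP[u0 u1]].
    by rewrite u0/= (ltW (lt_le_trans u1 _))// gerBl ltW.
  by rewrite u1 (le_trans _ u0)// subr_ge0.
rewrite ge0_integral_setU//; last 2 first.
- exact: measurable_funTS.
- rewrite disj_set2E; apply/eqP/seteqP; split => // u [] /=; rewrite !in_itv/=.
  by move=> /andP[_ h1] /andP[h2 _]; move: (lt_le_trans h1 h2); rewrite ltxx.
congr (_ + _).
rewrite (@ge0_integral_affine R c (1 - c)%R _ f c0)//; last exact: measurable_funTS.
have e1 u : (1 - c <= c * u + (1 - c))%R = (0 <= u)%R by rewrite lerDr pmulr_rge0.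
have e2 u : (c * u + (1 - c) <= 1)%R = (u <= 1)%R.
  rewrite -subr_ge0 (_ : _ - _ = c * (1 - u))%R; last by ring.
  by rewrite pmulr_rge0// subr_ge0.
congr (_ * integral _ _ _).
by apply/seteqP; split => u /=; rewrite !in_itv/= e1 e2.
Qed.

(* [z] is started from zero gaps and its front has reached the gap [k]; [y] is any other
   system, already coalesced with [z] ahead of the front and lagging behind it there. *)
Record front_pair (k : 'I_m) y z : Prop := FrontPair {
  front_nonnegl : nonneg_gaps y;
  front_nonnegr : nonneg_gaps z;
  front_below : forall i : 'I_m, (i < k)%N -> tnth y i = tnth z i;
  front_at : (tnth z k <= tnth y k)%R;
  front_above : forall i : 'I_m, (k < i)%N -> tnth z i = 0%R }.

Lemma front_le k y z i : front_pair k y z -> (tnth z i <= tnth y i)%R.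
Proof.
move=> [y0 z0 hb ha hab]; case: (ltngtP i k) => [ik|ki|/ord_inj ->//].
  by rewrite hb.
by rewrite hab.
Qed.

Lemma front_leader k y z (e : R) : (0 <= e)%R -> front_pair k y z ->
  front_pair k (leader_jump y e) (leader_jump z e).
Proof.
move=> e0 [y0 z0 hb ha hab]; split.
- exact: leader_jump_ge0.
- exact: leader_jump_ge0.
- by move=> i ik; rewrite !tnth_mktuple hb.
- by rewrite !tnth_mktuple; case: ifP => // _; rewrite lerD2r.
- by move=> i ki; rewrite tnth_mktuple gtn_eqF ?hab// (leq_ltn_trans _ ki).
Qed.

Lemma front_follower_below k y z (j : 'I_m) (u : R) : (0 <= u <= 1)%R -> (j < k)%N ->
  front_pair k y z -> front_pair k (follower_jump y j u) (follower_jump z j u).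
Proof.
move=> u01 jk [y0 z0 hb ha hab]; split.
- exact: follower_jump_ge0.
- exact: follower_jump_ge0.
- by move=> i ik; rewrite !tnth_mktuple !hb.
- rewrite !tnth_mktuple hb//; case: ifP => // _; case: ifP => // _.
  by rewrite lerD2r.
- move=> i ki; rewrite tnth_mktuple; have ji := ltn_trans jk ki.
  case: eqP => [ij|_]; first by move: ji; rewrite ij ltnn.
  by case: eqP => [ij|_]; [move: ki; rewrite ij ltnS leqNgt jk|exact: hab].
Qed.

(** Here [z] has a zero gap, hence jump rate zero, and only [y] moves. *)
Lemma front_follower_above k y z (j : 'I_m) (u : R) : (0 <= u <= 1)%R -> (k < j)%N ->
  front_pair k y z -> front_pair k (follower_jump y j u) z.
Proof.
move=> u01 kj [y0 z0 hb ha hab]; split => //.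
- exact: follower_jump_ge0.
- move=> i ik; have ij := ltn_trans ik kj.
  rewrite tnth_mktuple; case: eqP => [e|_]; first by move: ij; rewrite e ltnn.
  by rewrite ltn_eqF ?hb// ltnS ltnW.
- rewrite tnth_mktuple; case: eqP => [e|_]; first by move: kj; rewrite e ltnn.
  by rewrite ltn_eqF// ltnS ltnW.
Qed.

(* Only the copy with the larger gap moves: the target lies behind the other copy. *)
Lemma front_follower_ahead k y z (u : R) : (0 <= u <= 1)%R ->
  (tnth z k <= tnth y k - u * tnth y k)%R ->
  front_pair k y z -> front_pair k (follower_jump y k u) z.
Proof.
move=> u01 hu [y0 z0 hb ha hab]; split => //.
- exact: follower_jump_ge0.
- move=> i ik; rewrite tnth_mktuple; case: eqP => [e|_]; first by move: ik; rewrite e ltnn.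
  by rewrite ltn_eqF ?hb// ltnS ltnW.
- by rewrite tnth_mktuple eqxx.
Qed.

(** Both particles land at the same distance behind a predecessor they already share, so they
    coalesce and the front advances. Since [z] lagged less, its particle moved less far, which is
    the required order of the gaps at [k1]. *)
Lemma front_follower_meet k (k1 : 'I_m) y z (u v : R) :
  (0 <= u <= 1)%R -> (0 <= v <= 1)%R -> k1 = k.+1 :> nat ->
  (tnth y k - v * tnth y k = tnth z k - u * tnth z k)%R ->
  front_pair k y z -> front_pair k1 (follower_jump y k v) (follower_jump z k u).
Proof.
move=> u01 v01 k1E huv [y0 z0 hb ha hab].
have hv : (u * tnth z k <= v * tnth y k)%R.
  by rewrite -subr_ge0 (_ : _ - _ = tnth y k - tnth z k)%R ?subr_ge0//; move: huv; lra.
split.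
- exact: follower_jump_ge0.
- exact: follower_jump_ge0.
- move=> i; rewrite k1E ltnS leq_eqVlt => /orP[/eqP/ord_inj ->|ik].
    by rewrite !tnth_mktuple eqxx.
  rewrite !tnth_mktuple; case: eqP => [e|_]; first by move: ik; rewrite e ltnn.
  by rewrite ltn_eqF ?hb// ltnS ltnW.
- rewrite !tnth_mktuple; case: eqP => [e|_].
    by move: k1E => /eqP; rewrite e ltn_eqF.
  rewrite k1E eqxx lerD//; apply: (le_trans _ (y0 _)).
  by rewrite hab// k1E.
- move=> i; rewrite k1E => ki; rewrite tnth_mktuple; case: eqP => [e|_].
    by move: ki; rewrite e ltnNge leqnSn.
  by rewrite gtn_eqF ?hab// (ltn_trans _ ki).
Qed.

Lemma front_follower_last k y z (u v : R) :
  k.+1 = m :> nat ->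
  (tnth y k - v * tnth y k = tnth z k - u * tnth z k)%R ->
  front_pair k y z -> follower_jump y k v = follower_jump z k u.
Proof.
move=> kE huv [y0 z0 hb ha hab]; apply: eq_from_tnth => i.
rewrite !tnth_mktuple; case: eqP => [//|ik].
have ik' : (i < k)%N.
  have := ltn_ord i; rewrite -[X in (_ < X)%N]kE ltnS leq_eqVlt => /orP[/eqP/ord_inj//|//].
by rewrite ltn_eqF ?hb// ltnS ltnW.
Qed.

(* The jump of the last follower, which completes the coalescence, is removed. *)
Definition killed_jump z (f : T -> \bar R) : \bar R :=
  \int[leb]_(e in `[0%R, +oo[%classic) ((expR (- e))%:E * f (leader_jump z e))
  + \sum_(j < m) (if (j.+1 < m)%N then
      (tnth z j)%:E * \int[leb]_(u in `[0%R, 1%R]%classic) f (follower_jump z j u) else 0).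

Lemma killed_jumpZ z f (c : R) : nonneg_gaps z ->
  measurable_fun setT f -> (forall y, 0 <= f y) -> (0 <= c)%R ->
  killed_jump z (fun y => c%:E * f y) = c%:E * killed_jump z f.
Proof.
move=> y0 mf f0 c0; rewrite /killed_jump ge0_muleDr; last 2 first.
- by apply: integral_ge0 => e _; rewrite mule_ge0 ?lee_fin ?expR_ge0.
- apply: sume_ge0 => j _; case: ifP => // _.
  by rewrite mule_ge0 ?lee_fin//; apply: integral_ge0.
congr (_ + _).
  rewrite -ge0_integralZl_EFin//.
  - by apply: eq_integral => e _; rewrite muleCA.
  - by move=> e _; rewrite mule_ge0 ?lee_fin ?expR_ge0.
  - apply: measurable_funTS; apply: emeasurable_funM; first exact: measurable_expRN.
    exact: measurable_leader_fun.
rewrite ge0_sume_distrr => [|j _]; last first.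
  by case: ifP => // _; rewrite mule_ge0 ?lee_fin//; apply: integral_ge0.
apply: eq_bigr => j _; case: ifP => _; last by rewrite mule0.
rewrite muleCA; congr (_ * _).
by rewrite -ge0_integralZl_EFin//; apply: measurable_funTS; exact: measurable_follower_fun.
Qed.

End coupling.

(** * The coupling bound *)

Section coupling_bound.
Local Open Scope ereal_scope.
Variables (R : realType) (m : nat).
Notation leb := (@lebesgue_measure R).
Notation T := (m.-tuple R).
Implicit Types (y z : T) (k j : 'I_m).

Section one_jump.
Variables f1 f2 w : T -> \bar R.
Hypotheses (mf1 : measurable_fun setT f1) (mf2 : measurable_fun setT f2).
Hypothesis mw : measurable_fun setT w.
Hypotheses (f10 : forall y, 0 <= f1 y) (f20 : forall y, 0 <= f2 y).
Hypothesis w0 : forall y, 0 <= w y.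
Hypothesis f12 : forall y, nonneg_gaps y -> f1 y <= f2 y.
Hypothesis f12w : forall k y z, front_pair k y z -> f1 y <= f2 z + w z.

Let killed_term z j := if (j.+1 < m)%N then
  (tnth z j)%:E * \int[leb]_(u in `[0%R, 1%R]%classic) w (follower_jump z j u) else 0.

Let mff z j : measurable_fun (`[0%R, 1%R]%classic : set R)
  (fun u => f2 (follower_jump z j u)).
Proof. by apply: measurable_funTS; exact: measurable_follower_fun. Qed.

Let mwf z j : measurable_fun (`[0%R, 1%R]%classic : set R)
  (fun u => w (follower_jump z j u)).
Proof. by apply: measurable_funTS; exact: measurable_follower_fun. Qed.

(** The rate [tnth y j] splits into a common part [tnth z j] and an excess at which [y] moves alone.
    Ahead of the front there is no excess, behind it no common part; at the front both parts occur,
    separated by where the target falls. *)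
Lemma front_follower_term k y z j : front_pair k y z ->
  (tnth y j)%:E * \int[leb]_(u in `[0%R, 1%R]%classic) f1 (follower_jump y j u) <=
  (tnth z j)%:E * \int[leb]_(u in `[0%R, 1%R]%classic) f2 (follower_jump z j u)
  + killed_term z j + (tnth y j - tnth z j)%:E * (f2 z + w z).
Proof.
move=> h; have [y0 z0 hb ha hab] := h.
have fw0 z' : 0 <= f2 z' + w z' by rewrite adde_ge0.
have intw0 : 0 <= \int[leb]_(u in `[0%R, 1%R]%classic) w (follower_jump z j u).
  exact: integral_ge0.
have intf0 : 0 <= \int[leb]_(u in `[0%R, 1%R]%classic) f2 (follower_jump z j u).
  exact: integral_ge0.
have kt0 : 0 <= killed_term z j.
  by rewrite /killed_term; case: ifP => // _; rewrite mule_ge0 ?lee_fin.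
case: (ltngtP j k) => [jk|kj|/ord_inj jk].
- rewrite hb// subrr mul0e adde0 /killed_term ifT; last exact: leq_ltn_trans (ltn_ord k).
  rewrite -ge0_muleDr// -ge0_integralD//; try first [exact: mff | exact: mwf].
  apply: lee_wpmul2l; rewrite ?lee_fin//; apply: ge0_le_integral_nomeas => u u01 //.
  by apply: (@f12w k); apply: front_follower_below => //; exact: itv01_01.
- rewrite hab// subr0 mul0e add0e -[leLHS]add0e; apply: leeD; first exact: kt0.
  apply: lee_wpmul2l; rewrite ?lee_fin// -[leRHS]integral_itv01_cst.
  apply: ge0_le_integral_nomeas => u u01 //.
  by apply: (@f12w k); apply: front_follower_above => //; exact: itv01_01.
subst j; have [yk0|yk0] := eqVneq (tnth y k) 0%R.
  rewrite [X in X%:E * _ <= _]yk0 mul0e; apply: adde_ge0.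
    by apply: adde_ge0 => //; rewrite mule_ge0 ?lee_fin.
  by rewrite mule_ge0 ?lee_fin ?subr_ge0.
have yk : (0 < tnth y k)%R by rewrite lt_neqAle eq_sym yk0 y0.
(* With a zero gap in [z] there is no common part; the case is treated apart because the split below
   needs a positive ratio [c]. *)
have [zk0|zk0] := eqVneq (tnth z k) 0%R.
  rewrite zk0 mul0e add0e subr0 -[leLHS]add0e; apply: leeD; first exact: kt0.
  apply: lee_wpmul2l; rewrite ?lee_fin// -[leRHS]integral_itv01_cst.
  apply: ge0_le_integral_nomeas => u u01 //.
  apply: (@f12w k); apply: (front_follower_ahead (itv01_01 u01) _ h).
  have /andP[u0 u1] := itv01_01 u01.
  by rewrite zk0 subr_ge0 ler_piMl.
have zk : (0 < tnth z k)%R by rewrite lt_neqAle eq_sym zk0 z0.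
pose c := (tnth z k / tnth y k)%R.
have c01 : (0 < c <= 1)%R by rewrite divr_gt0//= ler_pdivrMr// mul1r.
have [c0 c1] := andP c01.
have cyz : (c * tnth y k = tnth z k)%R by rewrite divfK.
rewrite (ge0_integral_itv01_split c01 (measurable_follower_fun y k mf1)) //.
rewrite ge0_muleDr//; last 2 first.
- exact: integral_ge0.
- by rewrite mule_ge0 ?lee_fin ?(ltW c0)//; exact: integral_ge0.
rewrite addeC; apply: leeD.
  rewrite muleA -EFinM mulrC cyz.
  have meet u : (0 <= u <= 1)%R -> (tnth y k - (c * u + (1 - c)) * tnth y k = tnth z k - u * tnth z k)%R.
    by move=> _; rewrite -cyz; ring.
  have v01 u : (0 <= u <= 1)%R -> (0 <= c * u + (1 - c) <= 1)%R.
    by move=> /andP[u0 u1]; apply/andP; split; nra.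
  rewrite /killed_term; case: ifP => [km|km].
    rewrite -ge0_muleDr// -ge0_integralD//; try first [exact: mff | exact: mwf].
    apply: lee_wpmul2l; rewrite ?lee_fin//; apply: ge0_le_integral_nomeas => u /itv01_01 u01 //.
    apply: (@f12w (Ordinal km)); apply: (@front_follower_meet _ _ k) => //; first exact: v01.
    exact: meet.
  (* At the last gap the two states coincide after the jump, so [f12] applies without the error [w];
     this is the gain expressed by [killed_jump]. *)
  rewrite adde0; apply: lee_wpmul2l; rewrite ?lee_fin//.
  apply: ge0_le_integral_nomeas => u /itv01_01 u01 //.
  have kE : k.+1 = m :> nat by apply/eqP; rewrite eqn_leq ltn_ord leqNgt km.
  rewrite (front_follower_last kE (meet u u01) h); apply: f12.
  exact: follower_jump_ge0.
have -> : (tnth y k - tnth z k = tnth y k * (1 - c))%R by rewrite mulrBr mulr1 (mulrC _ c) cyz.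
rewrite EFinM -muleA; apply: lee_wpmul2l; rewrite ?lee_fin//.
apply: (@le_trans _ _ (\int[leb]_(u in `[0%R, (1 - c)%R[%classic) (f2 z + w z))).
  apply: ge0_le_integral_nomeas => u //; rewrite /= in_itv/= => /andP[u0 u1].
  apply: (@f12w k); apply: front_follower_ahead => //.
    by rewrite u0/= (le_trans (ltW u1))// gerBl ltW.
  by rewrite -cyz; nra.
rewrite integral_cst//= lebesgue_measure_itv/= lte_fin subr_gt0 oppr0 adde0.
case: ifPn => [_|h1]; first by rewrite muleC.
by rewrite mule0 mule_ge0// lee_fin subr_ge0.
Qed.

(** In the application [f1] is a truncated transition probability, [f2] the full one, and [w] the
    bound for not having coalesced. The last term is the excess rate of [y], during which [z] stays
    put: these are the phantom jumps of [z]. *)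
Lemma front_one_jump k y z : front_pair k y z ->
  sftl_jump y f1 <= sftl_jump z f2 + killed_jump z w
    + (sftl_rate y - sftl_rate z)%:E * (f2 z + w z).
Proof.
move=> h; have [y0 z0 hb ha hab] := h.
have fw0 : 0 <= f2 z + w z by rewrite adde_ge0.
have -> : (sftl_rate y - sftl_rate z)%:E * (f2 z + w z) =
    \sum_(j < m) ((tnth y j - tnth z j)%:E * (f2 z + w z)).
  rewrite -ge0_sume_distrl; last by move=> j _; rewrite lee_fin subr_ge0; exact: (front_le j h).
  by congr (_ * _); rewrite sumEFin sumrB; congr EFin; rewrite /sftl_rate; ring.
rewrite /sftl_jump /killed_jump addeACA -(addeA (_ + _)); apply: leeD.
  rewrite -ge0_integralD//; last 4 first.
  - by move=> e _; rewrite mule_ge0 ?lee_fin ?expR_ge0.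
  - apply: measurable_funTS; apply: emeasurable_funM; first exact: measurable_expRN.
    exact: measurable_leader_fun.
  - by move=> e _; rewrite mule_ge0 ?lee_fin ?expR_ge0.
  - apply: measurable_funTS; apply: emeasurable_funM; first exact: measurable_expRN.
    exact: measurable_leader_fun.
  apply: ge0_le_integral_nomeas => e /itv0y_ge0 e0.
    by rewrite mule_ge0 ?lee_fin ?expR_ge0.
  rewrite -ge0_muleDr//; apply: lee_wpmul2l; first by rewrite lee_fin expR_ge0.
  by apply: (@f12w k); exact: front_leader.
rewrite -!big_split/=; apply: lee_sum => j _; exact: (front_follower_term j h).
Qed.

End one_jump.

(** The drift hypothesis makes [expR (- (lam * t)) * V z] an upper bound for the probability that
    the last particle of [z] has not jumped by time t. It depends on [z] alone, so the bound is
    uniform in [y]. *)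
Lemma front_coupling (A : set T) (V : T -> R) (lam : R) : measurable A ->
  measurable_fun setT V -> (forall z, (0 <= V z)%R) ->
  (forall z, nonneg_gaps z -> (1 <= V z)%R) ->
  (forall z, nonneg_gaps z ->
     killed_jump z (fun y => (V y)%:E) <= ((sftl_rate z - lam) * V z)%:E) ->
  forall K (t : R) k y z, (0 <= t)%R -> front_pair k y z ->
  clamped_Psum A K t y <= clamped_P A t z + (expR (- (lam * t)) * V z)%:E.
Proof.
move=> mA mV V0 V1 dV; elim => [|K ih] t k y z t0 h.
  rewrite /clamped_Psum big_nil adde_ge0 ?clamped_P_ge0//.
  by rewrite lee_fin mulr_ge0 ?expR_ge0.
have [y0 z0 hb ha hab] := h.
have qyz : (sftl_rate z <= sftl_rate y)%R.
  by rewrite lerD2l; apply: ler_sum => j _; exact: (front_le j h).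
set Q := sftl_rate y; set q := sftl_rate z.
have mV' : measurable_fun setT (fun z => (V z)%:E) by apply/measurable_EFinP.
pose g r := sftl_jump z (clamped_P A r).
pose u r := clamped_P A r z.
pose G r := killed_jump z (fun z' => (expR (- (lam * r)))%:E * (V z')%:E)
  + (Q - q)%:E * (expR (- (lam * r)) * V z)%:E.
have mgP := measurable_clamped_P mA.
have g0 r : 0 <= g r by apply: sftl_jump_ge0 => // z' _; exact: clamped_P_ge0.
have u0 r : 0 <= u r by exact: clamped_P_ge0.
have mg : measurable_fun setT g.
  by apply: (@measurable_sftl_jump R m _ R (fun=> z) _ (clamped_P A)) => //; exact: clamped_P_ge0.
have mu : measurable_fun setT u by exact: (measurable_fun_pair1 z mgP).
have kV0 : 0 <= killed_jump z (fun z' => (V z')%:E).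
  apply: adde_ge0.
    by apply: integral_ge0 => e _; rewrite mule_ge0 ?lee_fin ?expR_ge0.
  apply: sume_ge0 => j _; case: ifP => // _; rewrite mule_ge0 ?lee_fin//.
  by apply: integral_ge0 => v _; rewrite lee_fin.
have GE r : G r = (expR (- (lam * r)))%:E *
    (killed_jump z (fun z' => (V z')%:E) + ((Q - q) * V z)%:E).
  rewrite ge0_muleDr//; last by rewrite lee_fin mulr_ge0 ?subr_ge0.
  rewrite /G killed_jumpZ ?expR_ge0//.
  by rewrite -!EFinM mulrCA.
have G0 r : 0 <= G r.
  rewrite GE mule_ge0 ?lee_fin ?expR_ge0// adde_ge0// lee_fin.
  by rewrite mulr_ge0 ?subr_ge0.
have Gle r : G r <= ((Q + - lam) * (V z * expR (- lam * r)))%:E.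
  rewrite GE (_ : ((Q + - lam) * (V z * expR (- lam * r)))%:E =
    (expR (- (lam * r)))%:E * ((Q - lam) * V z)%:E); last first.
    by rewrite -EFinM mulNr; congr EFin; ring.
  apply: lee_wpmul2l.
    by rewrite lee_fin expR_ge0.
  apply: (le_trans (leeD2r _ (dV z z0))); rewrite -EFinD lee_fin -mulrDl.
  by rewrite ler_wpM2r// le_eqVlt; apply/orP; left; apply/eqP; rewrite -/q; ring.
have mG : measurable_fun setT G.
  rewrite (_ : G = fun r => (expR (- (lam * r)))%:E *
    (killed_jump z (fun z' => (V z')%:E) + ((Q - q) * V z)%:E)); last by apply/funext.
  by apply: emeasurable_funM => //; exact: measurable_expRN_mul.
have mrefl (F : R -> \bar R) : measurable_fun setT F ->
    measurable_fun setT (fun s : R => (expR (- (Q * s)))%:E * F (t - s)%R).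
  move=> mF; apply: emeasurable_funM; first exact: measurable_expRN_mul.
  by apply: (measurableT_comp mF); exact: measurable_funB.
pose F1 r := g r + (Q - q)%:E * u r.
have F10 r : 0 <= F1 r by rewrite adde_ge0// mule_ge0// lee_fin subr_ge0.
have mF1 : measurable_fun setT F1 by apply: emeasurable_funD => //; exact: measurable_funeM.
have unif : \int[leb]_(s in `[0%R, t]%classic)
   ((expR (- (Q * s)))%:E * F1 (t - s)%R) <= u t.
  apply: (@duhamel_uniformization _ g u (\1_A z) q Q t) => // r r0.
  exact: clamped_P_rec.
have wbound : \int[leb]_(s in `[0%R, t]%classic) ((expR (- (Q * s)))%:E * G (t - s)%R) <=
    (V z * (expR (- lam * t) - expR (- (Q * t))))%:E.
  by apply: exp_duhamel_le => // r _; rewrite G0 Gle.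
rewrite clamped_Psum_rec//.
(* Without any jump, membership of [y] in [A] says nothing about [z]. The share
   [V z * expR (- (Q * t))] pays for that event, which is why [V] must be at least 1. *)
have -> : (expR (- (lam * t)) * V z = V z * expR (- (Q * t)) +
    V z * (expR (- lam * t) - expR (- (Q * t))))%R by rewrite mulNr; ring.
rewrite EFinD [leRHS]addeCA; apply: leeD.
  rewrite lee_fin mulrC ler_wpM2r ?expR_ge0//.
  apply: (le_trans _ (V1 z z0)); rewrite indicE.
  by case: (_ \in _).
apply: (le_trans _ (leeD unif wbound)).
rewrite -ge0_integralD//; last 4 first.
- by move=> s _; rewrite mule_ge0 ?lee_fin ?expR_ge0.
- by apply: measurable_funTS; exact: mrefl.
- by move=> s _; rewrite mule_ge0 ?lee_fin ?expR_ge0.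
- by apply: measurable_funTS; exact: mrefl.
apply: ge0_le_integral_nomeas => s /itv0t_bounds[s0 ts0].
  rewrite mule_ge0 ?lee_fin ?expR_ge0//.
  by apply: sftl_jump_ge0 => // z' _; exact: clamped_Psum_ge0.
rewrite -ge0_muleDr//; apply: lee_wpmul2l; first by rewrite lee_fin expR_ge0.
apply: (@le_trans _ _ (sftl_jump z (clamped_P A (t - s)%R) +
   killed_jump z (fun z' => (expR (- (lam * (t - s))))%:E * (V z')%:E) +
   (Q - q)%:E * (clamped_P A (t - s)%R z + (expR (- (lam * (t - s))))%:E * (V z)%:E))).
  apply: (@front_one_jump (clamped_Psum A K (t - s)%R) _
    (fun z' => (expR (- (lam * (t - s))))%:E * (V z')%:E) _ _ _ _ _ _ _ _ k) => //.
  - exact: (measurable_fun_pair2 (t - s)%R (measurable_clamped_Psum K mA)).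
  - exact: (measurable_fun_pair2 (t - s)%R mgP).
  - exact: measurable_funeM.
  - exact: clamped_Psum_ge0.
  - exact: clamped_P_ge0.
  - by move=> z'; rewrite mule_ge0 ?lee_fin ?expR_ge0.
  - by move=> z' _; exact: clamped_Psum_le_P.
  - by move=> k' y' z' h'; rewrite -EFinM; exact: (ih _ k').
rewrite ge0_muleDr//; last 2 first.
- exact: clamped_P_ge0.
- by rewrite mule_ge0 ?lee_fin ?expR_ge0.
by rewrite -EFinM addeACA.
Qed.

End coupling_bound.

(** * Coalescence from the zero configuration *)

Section mixing_upper.
Local Open Scope ereal_scope.
Variables (R : realType) (m' : nat).
Local Notation m := m'.+1.
Notation leb := (@lebesgue_measure R).
Notation T := (m.-tuple R).
Implicit Types (y z : T).
Let M : R := m%:R.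

Let M1 : (1 <= M)%R. Proof. by rewrite ler1n. Qed.

Definition lyap_weight (i : 'I_m) : R := (1 - (i : nat)%:R / (2 * M))%R.
Definition gap_sum z : R := (\sum_(i < m) tnth z i)%R.
(** The decreasing weights make each interior follower jump lower the linear part, while it leaves
    [gap_sum] unchanged. The exponential term keeps the function above 1 near zero gaps and
    decreases with each leader jump. *)
Definition lyap z : R :=
  (\sum_(i < m) lyap_weight i * tnth z i + 56 * M * expR (- (gap_sum z / (6 * M))))%R.

Lemma lyap_weight_ge i : (2^-1 <= lyap_weight i)%R.
Proof.
rewrite /lyap_weight lerBrDl -lerBrDr ler_pdivrMr ?mulr_gt0 ?(lt_le_trans _ M1)//.
have : ((i : nat)%:R <= M)%R by rewrite ler_nat ltnW.
by move: M1; lra.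
Qed.

Lemma lyap_weight_le1 i : (lyap_weight i <= 1)%R.
Proof. by rewrite gerBl divr_ge0// mulr_ge0// (le_trans _ M1). Qed.

Lemma sum_leader_jump (c : 'I_m -> R) z (e : R) :
  (\sum_(i < m) c i * tnth (leader_jump z e) i =
   \sum_(i < m) c i * tnth z i + c ord0 * e)%R.
Proof.
rewrite !big_ord_recl/= tnth_mktuple/= mulrDr addrAC; congr (_ + _ + _)%R.
by apply: eq_bigr => i _; rewrite tnth_mktuple.
Qed.

Lemma gap_sum_leader z (e : R) : gap_sum (leader_jump z e) = (gap_sum z + e)%R.
Proof.
have := sum_leader_jump (fun=> 1%R) z e.
rewrite mul1r /gap_sum.
under eq_bigr do rewrite mul1r.
by move=> ->; under eq_bigr do rewrite mul1r.
Qed.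

Lemma sum_follower_jump_next (c : 'I_m -> R) z (j : 'I_m) (jm : (j.+1 < m)%N) (u : R) :
  (\sum_(i < m) c i * tnth (follower_jump z j u) i =
   \sum_(i < m) c i * tnth z i - u * tnth z j * (c j - c (Ordinal jm)))%R.
Proof.
rewrite sum_follower_jump; congr (_ - _ * (_ - _))%R.
by apply: big_pred1 => i.
Qed.

Lemma gap_sum_follower z (j : 'I_m) (jm : (j.+1 < m)%N) (u : R) :
  gap_sum (follower_jump z j u) = gap_sum z.
Proof.
have := sum_follower_jump_next (fun=> 1%R) z jm u.
rewrite subrr mulr0 subr0 /gap_sum.
under eq_bigr do rewrite mul1r.
by move=> ->; under eq_bigr do rewrite mul1r.
Qed.

(** Cauchy-Schwarz, in the form that the variance of the gaps is nonnegative. *)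
Lemma gap_sum_sq_le z : (gap_sum z ^+ 2 / M <= \sum_(i < m) tnth z i ^+ 2)%R.
Proof.
have M0 : (0 < M)%R by exact: lt_le_trans M1.
have : (0 <= \sum_(i < m) (tnth z i - gap_sum z / M) ^+ 2)%R by apply: sumr_ge0 => i _; exact: sqr_ge0.
rewrite (eq_bigr (fun i => tnth z i ^+ 2 - (2 * (gap_sum z / M)) * tnth z i + (gap_sum z / M) ^+ 2)%R); last first.
  by move=> i _; ring.
rewrite big_split/= sumrB -mulr_sumr -/(gap_sum z) sumr_const card_ord -mulr_natl -/M.
move=> h; rewrite -subr_ge0 (le_trans h)// le_eqVlt; apply/orP; left; apply/eqP.
by field; rewrite gt_eqF.
Qed.

Lemma gap_sum_ge0 z : nonneg_gaps z -> (0 <= gap_sum z)%R.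
Proof. by move=> z0; apply: sumr_ge0. Qed.

Lemma lyap_ge0 z : nonneg_gaps z -> (0 <= lyap z)%R.
Proof.
move=> z0; rewrite addr_ge0//.
  apply: sumr_ge0 => i _; rewrite mulr_ge0//.
  by apply: le_trans (lyap_weight_ge i); rewrite invr_ge0.
by rewrite !mulr_ge0 ?expR_ge0// (le_trans _ M1).
Qed.

Lemma lyap_ge_half_sum z : nonneg_gaps z ->
  (gap_sum z / 2 <= \sum_(i < m) lyap_weight i * tnth z i)%R.
Proof.
move=> z0; rewrite /gap_sum mulr_suml; apply: ler_sum => i _.
by rewrite mulrC ler_wpM2r// lyap_weight_ge.
Qed.

Lemma lyap_ge_gap z j : nonneg_gaps z -> (tnth z j / 2 <= lyap z)%R.
Proof.
move=> z0; apply: (@le_trans _ _ (gap_sum z / 2)%R).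
  rewrite ler_wpM2r ?invr_ge0// /gap_sum (bigD1 j)//= lerDl.
  exact: sumr_ge0.
apply: (le_trans (lyap_ge_half_sum z0)); rewrite /lyap lerDl.
by rewrite !mulr_ge0 ?expR_ge0// (le_trans _ M1).
Qed.

(** If the total gap is at least 2 the linear part suffices, weights being at least 1/2. Otherwise
    the exponent is at most 1/3 and the exponential term is at least 28 M. *)
Lemma lyap_ge1 z : nonneg_gaps z -> (1 <= lyap z)%R.
Proof.
move=> z0; have D0 := gap_sum_ge0 z0; have M0 : (0 < M)%R by exact: lt_le_trans M1.
have h := lyap_ge_half_sum z0.
rewrite /lyap; set X := (gap_sum z / (6 * M))%R.
have hE := expR_ge1Dx (- X)%R.
have E0 := expR_ge0 (- X)%R.
set E := expR _ in hE E0 *.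
have [D2|D2] := leP 2%R (gap_sum z).
  apply: (@le_trans _ _ (gap_sum z / 2)%R); first by move: D2; lra.
  by apply: (le_trans h); rewrite lerDl !mulr_ge0// ltW.
have rle : (X <= 3^-1)%R.
  rewrite /X ler_pdivrMr ?mulr_gt0//; move: M1 D2; lra.
have E12 : (2^-1 <= E)%R by move: hE rle; lra.
have : (56 * M * 2^-1 <= 56 * M * E)%R by rewrite ler_wpM2l// mulr_ge0// ltW.
by move: M1 h D0; lra.
Qed.

Definition lyap_clamp z : R := lyap (clamp_gaps z).

Lemma measurable_lyap_clamp : measurable_fun setT lyap_clamp.
Proof.
apply: (measurableT_comp _ (@measurable_clamp_gaps R m)).
have mt i : measurable_fun setT (fun z : T => tnth z i) by exact: measurable_tnth.
apply: measurable_funD.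
  by apply: measurable_sum => i; apply: measurable_funM.
apply: measurable_funM => //; apply: measurableT_comp => //; apply: measurableT_comp => //.
by apply: measurable_funM => //; apply: measurable_sum.
Qed.

(** Let r = D / M and E = exp(-r/6). The leader raises the linear part by at most 2 and lowers [ph]
    by at least 8 E, because 56 M >= 8 (6 M + 1). The followers gain at least r^2/4, and the decay
    rate 1/(56 M) costs at most r/56 + E. There remains 2 + r/56 <= 7 E + r^2/4. *)
Lemma lyap_drift_real (S D Z ph : R) : (0 <= D)%R -> (S <= D)%R -> (0 <= S)%R ->
  (D ^+ 2 / M <= Z)%R -> ph = (56 * M * expR (- (D / (6 * M))))%R ->
  (S + 2 * 1 + ph / (1 + (6 * M)^-1) + (D * (S + ph) - Z / (4 * M))
    <= (1 + D - (56 * M)^-1) * (S + ph))%R.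
Proof.
move=> D0 SD S0 DZ phE; have M0 : (0 < M)%R by exact: lt_le_trans M1.
set r := (D / M)%R.
have r0 : (0 <= r)%R by rewrite divr_ge0// ltW.
have DE : (D = r * M)%R by rewrite /r divfK ?gt_eqF.
set E := expR (- (D / (6 * M)))%R.
have rE : (D / (6 * M) = r / 6)%R by rewrite DE; field; rewrite gt_eqF.
have hE : (1 - r / 6 <= E)%R by rewrite /E rE; exact: expR_ge1Dx.
have E0 : (0 <= E)%R by exact: expR_ge0.
have ph_loss : (ph / (1 + (6 * M)^-1) <= ph - 8 * E)%R.
  have -> : (ph / (1 + (6 * M)^-1) = ph - ph / (6 * M + 1))%R.
    by field; apply/andP; split; rewrite gt_eqF// addr_gt0// mulr_gt0.
  rewrite lerD2l lerN2 ler_pdivlMr ?addr_gt0 ?mulr_gt0//.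
  rewrite phE -/E; have : (0 <= E * (M - 1))%R by rewrite mulr_ge0// subr_ge0.
  lra.
have Z_gain : (r ^+ 2 / 4 <= Z / (4 * M))%R.
  rewrite ler_pdivlMr ?mulr_gt0//.
  rewrite (_ : r ^+ 2 / 4 * (4 * M) = D ^+ 2 / M)%R//.
  by rewrite /r; field; rewrite gt_eqF.
have lam_le : ((56 * M)^-1 * (S + ph) <= r / 56 + E)%R.
  have -> : (r / 56 + E = (56 * M)^-1 * (D + ph))%R.
    by rewrite phE -/E /r; field; rewrite gt_eqF.
  by rewrite ler_wpM2l ?lerD2r// invr_ge0 mulr_ge0// ltW.
have key : (2 + ph / (1 + (6 * M)^-1) + (56 * M)^-1 * (S + ph) <= ph + Z / (4 * M))%R.
  (* With E >= 1 - r/6 it suffices that r^2/4 - (7/6 + 1/56) r + 5 >= 0. The linear coefficient is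
     below 6/5, so this square settles it. *)
  have sq : (0 <= (r / 2 - 6 / 5) ^+ 2)%R by exact: sqr_ge0.
  move: ph_loss Z_gain lam_le; move: (ph / _)%R (Z / _)%R ((56 * M)^-1 * _)%R => X Y L.
  move: hE r0 sq; nra.
rewrite -subr_ge0; move: key; rewrite -subr_ge0; congr (is_true (0 <= _)%R).
by ring.
Qed.

Lemma lyap_drift z : nonneg_gaps z ->
  killed_jump z (fun y => (lyap_clamp y)%:E) <=
  ((sftl_rate z - (56 * M)^-1) * lyap_clamp z)%:E.
Proof.
move=> z0; have M0 : (0 < M)%R by exact: lt_le_trans M1.
have lc y : nonneg_gaps y -> lyap_clamp y = lyap y by move=> y0; rewrite /lyap_clamp clamp_gaps_id.
rewrite lc//.
set S := (\sum_(i < m) lyap_weight i * tnth z i)%R.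
set ph := (56 * M * expR (- (gap_sum z / (6 * M))))%R.
have VE : lyap z = (S + ph)%R by [].
have S0 : (0 <= S)%R.
  by apply: le_trans (lyap_ge_half_sum z0); rewrite divr_ge0 ?gap_sum_ge0.
have ph0 : (0 <= ph)%R by rewrite !mulr_ge0 ?expR_ge0// ltW.
apply: (@le_trans _ _ ((S + 2 * 1 + ph / (1 + (6 * M)^-1))%:E +
   \sum_(j < m) (tnth z j * lyap z - tnth z j ^+ 2 / (4 * M))%:E)).
  apply: leeD.
    apply: leader_integral_le => //; first by rewrite addr_gt0 ?invr_gt0 ?mulr_gt0.
    move=> e e0; have le0 := leader_jump_ge0 z0 e0.
    rewrite lc// !lee_fin lyap_ge0//= /lyap sum_leader_jump gap_sum_leader.
    rewrite le_eqVlt; apply/orP; left; apply/eqP; congr (_ + _ * _ + _)%R.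
      by rewrite /lyap_weight mul0r subr0.
    rewrite /ph -[RHS]mulrA -expRD; congr (_ * expR _)%R.
    by field; rewrite gt_eqF.
  apply: lee_sum => j _; have zj0 := z0 j; have Vj := lyap_ge_gap j z0.
  have zsq : (tnth z j ^+ 2 / (4 * M) <= tnth z j * lyap z)%R.
    rewrite expr2 -mulrA ler_wpM2l//; apply: le_trans Vj.
    by rewrite ler_wpM2l// lef_pV2 ?posrE ?mulr_gt0//; move: M1; lra.
  (* For the last gap the killed jump contributes 0, while the common formula allots it a quantity
     that [zsq] shows nonnegative; the sum over all gaps thus keeps all the squares. *)
  case: ifPn => [jm|_]; last by rewrite lee_fin subr_ge0.
  have -> : (tnth z j * lyap z - tnth z j ^+ 2 / (4 * M) =
      tnth z j * (lyap z - tnth z j / (2 * M) / 2))%R by field; rewrite gt_eqF.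
  rewrite EFinM; apply: lee_wpmul2l; rewrite ?lee_fin//.
  rewrite -integral_itv01_affine; last 2 first.
  - by rewrite divr_ge0// mulr_ge0// ltW.
  - apply: le_trans Vj.
    by rewrite ler_wpM2l// lef_pV2 ?posrE ?mulr_gt0//; move: M1; lra.
  apply: ge0_le_integral_nomeas => u /itv01_01 u01; have fj0 := follower_jump_ge0 j z0 u01.
    by rewrite lc// lee_fin lyap_ge0.
  rewrite lc// lee_fin /lyap sum_follower_jump_next gap_sum_follower// -/S -/ph.
  rewrite addrAC lerD2l lerN2 le_eqVlt; apply/orP; left; apply/eqP.
  rewrite /lyap_weight/= -natr1; field; rewrite gt_eqF//.
rewrite sumEFin -EFinD lee_fin sumrB -mulr_suml -mulr_suml -/(gap_sum z) VE /sftl_rate -/(gap_sum z).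
apply: lyap_drift_real => //.
- exact: gap_sum_ge0.
- by apply: ler_sum => i _; rewrite ler_piMl// lyap_weight_le1.
- exact: gap_sum_sq_le.
Qed.

Definition zero_gaps : T := [tuple 0%R | _ < m].

Lemma zero_gaps_ge0 : nonneg_gaps zero_gaps.
Proof. by move=> i; rewrite tnth_mktuple. Qed.

Lemma lyap_zero : lyap_clamp zero_gaps = (56 * M)%R.
Proof.
rewrite /lyap_clamp clamp_gaps_id; last exact: zero_gaps_ge0.
rewrite /lyap big1 => [|i _]; last by rewrite tnth_mktuple mulr0.
rewrite /gap_sum big1 => [|i _]; last by rewrite tnth_mktuple.
by rewrite mul0r oppr0 expR0 add0r mulr1.
Qed.

Lemma clamped_P_le_zero A (t : R) y : measurable A -> (0 <= t)%R -> nonneg_gaps y ->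
  clamped_P A t y <= clamped_P A t zero_gaps + (expR (- ((56 * M)^-1 * t)) * (56 * M))%:E.
Proof.
move=> mA t0 y0; apply: clamped_P_le => K; rewrite -[X in (_ * X)%:E]lyap_zero.
have zg := zero_gaps_ge0.
apply: (@front_coupling R m A lyap_clamp (56 * M)^-1 mA _ _ _ _ K t ord0) => //.
- exact: measurable_lyap_clamp.
- by move=> z; apply: lyap_ge0; exact: clamp_gaps_ge0.
- by move=> z z0; apply: lyap_ge1; exact: clamp_gaps_ge0.
- exact: lyap_drift.
- by split => // [|i _]; rewrite tnth_mktuple.
Qed.

(* The reverse inequality is the previous one for the complement of A, because the total
   mass is one. *)
Lemma clamped_P_ge_zero A (t : R) y : measurable A -> (0 <= t)%R -> nonneg_gaps y ->
  clamped_P A t zero_gaps <= clamped_P A t y + (expR (- ((56 * M)^-1 * t)) * (56 * M))%:E.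
Proof.
move=> mA t0 y0; have zg := zero_gaps_ge0.
have mAC := measurableC mA.
have h := clamped_P_le_zero mAC t0 y0.
have sy := clamped_P_setC t mA y0; have sz := clamped_P_setC t mA zg.
rewrite clamped_P_setT// in sy; rewrite clamped_P_setT// in sz.
have fin (B : set T) x : measurable B -> nonneg_gaps x -> clamped_P B t x \is a fin_num.
  move=> mB x0; rewrite ge0_fin_numE ?clamped_P_ge0//.
  by rewrite (le_lt_trans (clamped_P_le1 mB t0 x0)) ?ltry.
move: h sy sz.
rewrite -(fineK (fin _ _ mA y0)) -(fineK (fin _ _ mA zg)) -(fineK (fin _ _ mAC y0)) -(fineK (fin _ _ mAC zg)).
rewrite -!EFinD !lee_fin => h [sy] [sz]; move: h sy sz; lra.
Qed.

(** Both states are compared with the zero configuration, whence the factor 2. *)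
Lemma clamped_P_close A (t : R) y z : measurable A -> (0 <= t)%R ->
  nonneg_gaps y -> nonneg_gaps z ->
  clamped_P A t y <= clamped_P A t z + (2 * (expR (- ((56 * M)^-1 * t)) * (56 * M)))%:E.
Proof.
move=> mA t0 y0 z0; apply: (le_trans (clamped_P_le_zero mA t0 y0)).
set x := (expR _ * _)%R; have -> : (2 * x = x + x)%R by ring.
by rewrite EFinD addeA leeD2r//; exact: clamped_P_ge_zero.
Qed.

End mixing_upper.

(** * Speed of propagation *)

Section mixing_lower.
Local Open Scope ereal_scope.
Variables (R : realType) (m' : nat) (delta : R).
Local Notation m := m'.+1.
Notation leb := (@lebesgue_measure R).
Notation T := (m.-tuple R).
Implicit Types (y : T).
Hypothesis delta01 : (0 < delta <= 1)%R.

Lemma expR_half_le2 : (expR 2^-1 <= 2 :> R)%R.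
Proof.
have h := expR_ge1Dx (- 2^-1 : R)%R; rewrite expRN in h.
have e0 : (0 < expR 2^-1 :> R)%R by exact: expR_gt0.
rewrite -lef_pV2 ?posrE//; apply: le_trans h; lra.
Qed.

(** The indicator is written as a 0/1 weight so that the formulas for weighted gap sums apply. *)
Definition tail_sum (i : 'I_m) y : R := (\sum_(j < m) (i <= j)%N%:R * tnth y j)%R.

Lemma tail_sum_ge0 i y : nonneg_gaps y -> (0 <= tail_sum i y)%R.
Proof. by move=> y0; apply: sumr_ge0 => j _; rewrite mulr_ge0. Qed.

Lemma tail_sum_leader i y (e : R) :
  tail_sum i (leader_jump y e) = (tail_sum i y + ((i : nat) == 0%N)%:R * e)%R.
Proof. by rewrite /tail_sum sum_leader_jump leqn0. Qed.

Lemma tail_sum_follower i y (j : 'I_m) (jm : (j.+1 < m)%N) (u : R) :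
  tail_sum i (follower_jump y j u) =
  (tail_sum i y + ((i : nat) == j.+1)%:R * (u * tnth y j))%R.
Proof.
rewrite /tail_sum sum_follower_jump_next/= -mulrN mulrC opprB; congr (_ + _ * _)%R.
rewrite (leq_eqVlt i j.+1) ltnS; case: eqP => [ij|_] /=.
  by rewrite ij ltnn subr0.
by rewrite subrr.
Qed.

Lemma tail_sum_follower_le i y (j : 'I_m) (u : R) : nonneg_gaps y -> (0 <= u)%R ->
  (j.+1 < m)%N = false -> (tail_sum i (follower_jump y j u) <= tail_sum i y)%R.
Proof.
move=> y0 u0 jm; rewrite /tail_sum sum_follower_jump.
have -> : (\sum_(k < m | k == j.+1 :> nat) (i <= k)%N%:R = 0 :> R)%R.
  by apply: big1 => k /eqP kj; have := ltn_ord k; rewrite kj jm.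
by rewrite subr0 gerBl !mulr_ge0.
Qed.

Lemma tail_sum_next y (j : 'I_m) (jm : (j.+1 < m)%N) :
  tail_sum j y = (tnth y j + tail_sum (Ordinal jm) y)%R.
Proof.
rewrite /tail_sum (bigD1 j)//= leqnn mul1r; congr (_ + _)%R.
rewrite [RHS](bigD1 j)//= ltnn mul0r add0r; apply: eq_bigr => i ij.
by rewrite leq_eqVlt eq_sym val_eqE (negbTE ij).
Qed.

(* Chosen so that the integral of front_fun over [0, z] is at most 2 * front_fun z, which
   closes the recursion from one tail sum to the next. *)
Definition front_fun (z : R) : R := (\1_(`]delta, +oo[%classic) z * expR (z / 2))%R.

Lemma front_funE (z : R) : front_fun z = (if (delta < z)%R then expR (z / 2) else 0)%R.
Proof.
rewrite /front_fun indicE; case: ifPn => dz.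
  by rewrite mem_set ?mul1r//= in_itv/= dz.
by rewrite memNset ?mul0r//= in_itv/= andbT; exact/negP.
Qed.

Lemma front_fun_ge0 (z : R) : (0 <= front_fun z)%R.
Proof. by rewrite front_funE; case: ifP => // _; exact: expR_ge0. Qed.

Lemma le_front_fun (z z' : R) : (z <= z')%R -> (front_fun z <= front_fun z')%R.
Proof.
move=> zz; rewrite !front_funE; case: ifPn => dz; last by case: ifP => // _; exact: expR_ge0.
by rewrite (lt_le_trans dz zz) ler_expR ler_wpM2r.
Qed.

Lemma measurable_front_fun : measurable_fun setT front_fun.
Proof.
apply: measurable_funM; first exact: measurable_indic.
by apply: measurableT_comp => //; apply: measurable_funM.
Qed.

(** The last index has weight 1, and each step towards the leader divides by 32: reaching the last
    gap requires passing through all the others. *)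
Definition speed_weight (i : nat) : R := (32^-1 ^+ (m' - i))%R.

Lemma speed_weight_ge0 i : (0 <= speed_weight i)%R.
Proof. by rewrite exprn_ge0// invr_ge0. Qed.

Lemma speed_weightS j : (j < m')%N -> (speed_weight j.+1 = 32 * speed_weight j)%R.
Proof.
move=> jm; rewrite /speed_weight -(subnSK jm) exprS mulrA mulfV ?mul1r//.
Qed.

(** The solution c of 65 c = 4 [speed_weight 0]: it absorbs the constant source created by the
    leader. *)
Definition front_const : R := (4 / 65 * 32^-1 ^+ m')%R.

Definition front_lyap y : R :=
  (\sum_(i < m) speed_weight i * front_fun (tail_sum i y) + front_const)%R.

Definition front_lyap_clamp y := front_lyap (clamp_gaps y).

Lemma front_const_ge0 : (0 <= front_const)%R.
Proof. by rewrite mulr_ge0 ?exprn_ge0 ?invr_ge0// divr_ge0. Qed.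

Lemma front_lyap_ge0 y : (0 <= front_lyap y)%R.
Proof.
rewrite addr_ge0 ?front_const_ge0//; apply: sumr_ge0 => i _.
by rewrite mulr_ge0 ?speed_weight_ge0 ?front_fun_ge0.
Qed.

Lemma measurable_front_lyap_clamp : measurable_fun setT front_lyap_clamp.
Proof.
apply: (measurableT_comp _ (@measurable_clamp_gaps R m)).
apply: measurable_funD => //; apply: measurable_sum => i.
apply: measurable_funM => //; apply: (measurableT_comp measurable_front_fun).
by apply: measurable_sum => j; apply: measurable_funM => //; exact: measurable_tnth.
Qed.

Lemma front_fun_leader (z e : R) : (0 <= e)%R ->
  (front_fun (z + e) <= (front_fun z + 2) * expR (- (- 2^-1 * e)))%R.
Proof.
move=> e0; have -> : (- (- 2^-1 * e) = e / 2)%R by rewrite mulNr opprK mulrC.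
have E0 : (0 <= expR (e / 2))%R by exact: expR_ge0.
rewrite !front_funE; case: ifPn => dze; last first.
  rewrite mulr_ge0// addr_ge0//; case: ifP => // _; exact: expR_ge0.
rewrite mulrDl expRD; case: ifPn => dz.
  by rewrite mulrDl lerDl mulr_ge0.
rewrite add0r ler_wpM2r//; apply: le_trans expR_half_le2.
rewrite ler_expR -[leRHS]mul1r ler_wpM2r//.
by move: dz; rewrite -leNgt => /le_trans; apply; case/andP: delta01.
Qed.

(** After substitution the left side is the integral of [front_fun] from [x] to [v + x], at most 2
    (exp((v+x)/2) - exp(x/2)); it vanishes if the endpoint does not exceed [delta]. *)
Lemma front_fun_follower (x v : R) : (0 <= x)%R -> (0 <= v)%R ->
  v%:E * \int[leb]_(u in `[0%R, 1%R]%classic) (front_fun (x + u * v))%:E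
  <= (2 * front_fun (v + x))%:E.
Proof.
move=> x0 v0; rewrite front_funE.
case: ifPn => [dxv|]; last first.
  rewrite -leNgt => dxv; rewrite mulr0 (_ : \int[leb]_(u in _) _ = 0) ?mule0//.
  apply: integral0_eq => u /itv01_01/andP[u0 u1]; rewrite front_funE ifF//.
  apply/negbTE; rewrite -leNgt (le_trans _ dxv)// addrC lerD2r.
  by rewrite -[leRHS]mul1r ler_wpM2r.
apply: (@le_trans _ _ (v%:E * \int[leb]_(u in `[0%R, 1%R]%classic)
   ((expR (x / 2))%:E * (expR (- (- (v / 2) * u)))%:E))).
  apply: lee_wpmul2l; rewrite ?lee_fin//.
  apply: ge0_le_integral_nomeas => u /itv01_01/andP[u0 u1].
    by rewrite lee_fin front_fun_ge0.
  rewrite -EFinM lee_fin -expRD front_funE; case: ifPn => _; last exact: expR_ge0.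
  by rewrite ler_expR le_eqVlt; apply/orP; left; apply/eqP; field.
rewrite ge0_integralZl_EFin ?expR_ge0//; last first.
  by apply: measurable_funTS; exact: measurable_expRN_mul.
have h := @integral_itv0_expN R (- (v / 2))%R 1%R ler01.
set I := \int[leb]_(u in _) _ in h *.
have I0 : 0 <= I by apply: integral_ge0 => u _; rewrite lee_fin expR_ge0.
have -> : v%:E * ((expR (x / 2))%:E * I) = (2 * expR (x / 2))%:E * ((v / 2)%:E * I).
  rewrite !muleA -!EFinM; congr (_%:E * _); by field.
have -> : (v / 2)%:E * I = (expR (v / 2) - 1)%:E.
  move: h; rewrite EFinN mulNe => /(congr1 -%E); rewrite oppeK => ->.
  by rewrite -EFinN mulr1 opprK opprB.
rewrite -EFinM lee_fin -mulrA ler_wpM2l//.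
rewrite mulrDl (expRD (v / 2)) mulrC ler_wpM2r ?expR_ge0//.
by rewrite gerBl.
Qed.

Lemma front_lyap_leader y : nonneg_gaps y ->
  \int[leb]_(e in `[0%R, +oo[%classic) ((expR (- e))%:E * (front_lyap_clamp (leader_jump y e))%:E)
  <= (front_lyap y + speed_weight 0 * front_fun (tail_sum ord0 y) + 4 * speed_weight 0)%:E.
Proof.
move=> y0.
pose rest := (\sum_(i < m') speed_weight i.+1 * front_fun (tail_sum (lift ord0 i) y) + front_const)%R.
have rest0 : (0 <= rest)%R.
  rewrite addr_ge0 ?front_const_ge0//; apply: sumr_ge0 => i _.
  by rewrite mulr_ge0 ?speed_weight_ge0 ?front_fun_ge0.
have GE : front_lyap y = (speed_weight 0 * front_fun (tail_sum ord0 y) + rest)%R.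
  by rewrite /front_lyap big_ord_recl addrA.
apply: (@le_trans _ _ (rest + 2 * 0 +
   (speed_weight 0 * (front_fun (tail_sum ord0 y) + 2)) / (1 + - 2^-1))%:E).
  apply: leader_integral_le => //.
  - by rewrite mulr_ge0 ?speed_weight_ge0// addr_ge0 ?front_fun_ge0.
  - by rewrite subr_gt0 invf_lt1// ltr1n.
  move=> e e0; have le0 := leader_jump_ge0 y0 e0.
  rewrite /front_lyap_clamp clamp_gaps_id// !lee_fin front_lyap_ge0/= mul0r addr0.
  rewrite /front_lyap big_ord_recl tail_sum_leader/= mul1r -addrA addrC.
  apply: lerD; last first.
    by rewrite -mulrA ler_wpM2l ?speed_weight_ge0// front_fun_leader.
  rewrite lerD2r; apply: ler_sum => i _.
  by rewrite tail_sum_leader mul0r addr0.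
rewrite lee_fin GE; have -> : (1 + - 2^-1 = 2^-1 :> R)%R by field.
rewrite invrK; lra.
Qed.

(** A jump of gap j affects, among the tail sums, only that of index j+1 (or only lowers them if j
    is last). Its contribution 2 [speed_weight j.+1] equals 64 [speed_weight j]; the leader adds one
    more copy of the first term, giving 65. *)
Lemma front_lyap_drift y : nonneg_gaps y ->
  sftl_jump y (fun z => (front_lyap_clamp z)%:E) <=
  ((sftl_rate y + 65) * front_lyap_clamp y)%:E.
Proof.
move=> y0; rewrite [front_lyap_clamp y]/front_lyap_clamp (clamp_gaps_id y0).
set G := front_lyap y.
have G0 : (0 <= G)%R by exact: front_lyap_ge0.
apply: (@le_trans _ _ ((G + speed_weight 0 * front_fun (tail_sum ord0 y) + 4 * speed_weight 0)%:E +
   \sum_(j < m) (tnth y j * G + 64 * (speed_weight j * front_fun (tail_sum j y)))%:E)).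
  apply: leeD; first exact: front_lyap_leader.
  apply: lee_sum => j _.
  have wK0 : (0 <= speed_weight j * front_fun (tail_sum j y))%R.
    by rewrite mulr_ge0 ?speed_weight_ge0 ?front_fun_ge0.
  case: (boolP (j.+1 < m)%N) => [jm|/negbTE jm]; last first.
    apply: (@le_trans _ _ ((tnth y j)%:E * G%:E)); last first.
      by rewrite -EFinM lee_fin lerDl mulr_ge0.
    apply: lee_wpmul2l; rewrite ?lee_fin// -[leRHS]integral_itv01_cst.
    apply: ge0_le_integral_nomeas => u u01; first by rewrite lee_fin front_lyap_ge0.
    have /andP[u0 u1] := itv01_01 u01.
    rewrite lee_fin /front_lyap_clamp clamp_gaps_id; last exact: follower_jump_ge0 (itv01_01 u01).
    rewrite lerD2r; apply: ler_sum => i _; rewrite ler_wpM2l ?speed_weight_ge0//.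
    by apply: le_front_fun; exact: tail_sum_follower_le.
  have mK : measurable_fun (`[0%R, 1%R]%classic : set R)
      (fun u => (front_fun (tail_sum (Ordinal jm) y + u * tnth y j))%:E).
    apply: measurable_funTS; apply/measurable_EFinP; apply: (measurableT_comp measurable_front_fun).
    by apply: measurable_funD => //; apply: measurable_funM.
  apply: (@le_trans _ _ ((tnth y j)%:E * \int[leb]_(u in `[0%R, 1%R]%classic)
     (G%:E + (speed_weight j.+1)%:E * (front_fun (tail_sum (Ordinal jm) y + u * tnth y j))%:E))).
    apply: lee_wpmul2l; rewrite ?lee_fin//.
    apply: ge0_le_integral_nomeas => u u01; first by rewrite lee_fin front_lyap_ge0.
    have /andP[u0 u1] := itv01_01 u01.
    rewrite -EFinM -EFinD lee_fin /front_lyap_clamp clamp_gaps_id; last exact: follower_jump_ge0 (itv01_01 u01).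
    have en : (Ordinal jm : nat) == j.+1 by exact: eqxx.
    have e : tail_sum (Ordinal jm) (follower_jump y j u) =
        (tail_sum (Ordinal jm) y + u * tnth y j)%R.
      by rewrite (tail_sum_follower _ _ jm) en mul1r.
    rewrite /G /front_lyap addrAC lerD2r (bigD1 (Ordinal jm))//= [X in (_ <= X + _)%R](bigD1 (Ordinal jm))//=.
    rewrite e addrC lerD//.
      rewrite -[leLHS]add0r lerD// ?mulr_ge0 ?speed_weight_ge0 ?front_fun_ge0//.
      apply: ler_sum => i ij; rewrite (tail_sum_follower _ _ jm).
      have -> : ((i : nat) == j.+1) = false by apply/negbTE; move: ij; rewrite -val_eqE.
      by rewrite mul0r addr0.
  rewrite ge0_integralD//; last 2 first.
  - by move=> u _; rewrite mule_ge0 ?lee_fin ?speed_weight_ge0 ?front_fun_ge0.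
  - exact: measurable_funeM.
  rewrite integral_itv01_cst ge0_integralZl_EFin ?speed_weight_ge0//; last first.
    by move=> u _; rewrite lee_fin front_fun_ge0.
  have I0 : 0 <= \int[leb]_(u in `[0%R, 1%R]%classic)
     (front_fun (tail_sum (Ordinal jm) y + u * tnth y j))%:E.
    by apply: integral_ge0 => u _; rewrite lee_fin front_fun_ge0.
  rewrite ge0_muleDr ?lee_fin//; last by rewrite mule_ge0 ?lee_fin ?speed_weight_ge0.
  rewrite (EFinD (tnth y j * G)) (EFinM (tnth y j) G); apply: leeD => //; rewrite muleCA.
  apply: (@le_trans _ _ ((speed_weight j.+1)%:E * (2 * front_fun (tail_sum j y))%:E)).
    apply: lee_wpmul2l; first by rewrite lee_fin speed_weight_ge0.
    rewrite (tail_sum_next y jm); apply: front_fun_follower => //.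
    exact: tail_sum_ge0.
  rewrite -EFinM lee_fin speed_weightS// le_eqVlt; apply/orP; left; apply/eqP; ring.
rewrite sumEFin -EFinD lee_fin big_split/= -mulr_suml -mulr_sumr.
have GE : (\sum_(i < m) speed_weight i * front_fun (tail_sum i y) = G - front_const)%R.
  by rewrite /G /front_lyap addrK.
rewrite GE.
have wK0 : (speed_weight 0 * front_fun (tail_sum ord0 y) <= G - front_const)%R.
  rewrite -GE (bigD1 ord0)//= lerDl; apply: sumr_ge0 => i _.
  by rewrite mulr_ge0 ?speed_weight_ge0 ?front_fun_ge0.
have cE : (65 * front_const = 4 * speed_weight 0)%R.
  by rewrite /front_const /speed_weight subn0; field.
rewrite /sftl_rate; move: wK0 cE; set D := (\sum_(i < m) tnth y i)%R.
rewrite !mulrDl mul1r; lra.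
Qed.

Definition last_gap_set : set T := [set y | (delta < tnth y ord_max)%R].

Lemma measurable_last_gap_set : measurable last_gap_set.
Proof.
rewrite (_ : last_gap_set = setT `&` (fun y : T => tnth y ord_max) @^-1` `]delta, +oo[%classic).
  by apply: measurable_tnth => //; exact: measurable_itv.
by apply/seteqP; split => y; rewrite /last_gap_set/= in_itv/= andbT; [|case].
Qed.

Lemma front_lyap_last y : nonneg_gaps y -> last_gap_set y -> (1 <= front_lyap_clamp y)%R.
Proof.
move=> y0 hy; rewrite /front_lyap_clamp clamp_gaps_id//.
rewrite /front_lyap (bigD1 ord_max)//= /speed_weight subnn expr0 mul1r -addrA.
rewrite -[leLHS]addr0 lerD//; last first.
  rewrite addr_ge0 ?front_const_ge0//; apply: sumr_ge0 => i _.
  by rewrite mulr_ge0 ?front_fun_ge0// exprn_ge0// invr_ge0.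
have -> : tail_sum ord_max y = tnth y ord_max.
  rewrite /tail_sum (bigD1 ord_max)//= leqnn mul1r big1 ?addr0// => i im.
  rewrite leqNgt (_ : (i < m')%N) ?mul0r//.
  by have := ltn_ord i; rewrite ltnS leq_eqVlt => /orP[/eqP h|//]; move: im; rewrite -val_eqE /= h eqxx.
rewrite front_funE ifT// -[leLHS]expR0 ler_expR divr_ge0//.
Qed.

(** When the total gap is at most [delta] every [front_fun] term vanishes, and the Lyapunov function
    starts from [front_const] alone. *)
Lemma clamped_P_last_gap (t : R) y : (0 <= t)%R -> nonneg_gaps y ->
  (\sum_(i < m) tnth y i <= delta)%R ->
  clamped_P last_gap_set t y <= (expR (65 * t) * front_const)%:E.
Proof.
move=> t0 y0 yd; apply: clamped_P_le => K.
have -> : front_const = front_lyap_clamp y.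
  rewrite /front_lyap_clamp clamp_gaps_id// /front_lyap big1 ?add0r// => i _.
  rewrite front_funE ifF ?mulr0//; apply/negbTE; rewrite -leNgt (le_trans _ yd)//.
  by apply: ler_sum => j _; rewrite ler_piMl// lern1 leq_b1.
apply: sftl_supersolution => //.
- exact: measurable_last_gap_set.
- exact: measurable_front_lyap_clamp.
- by move=> z; exact: front_lyap_ge0.
- exact: front_lyap_last.
- exact: front_lyap_drift.
Qed.

End mixing_lower.

(** * Mixing time *)

Section total_variation.
Local Open Scope ereal_scope.
Variables (R : realType).
Import HBNNSimple.

(** Measurability of [f] is not assumed: [sftl_P] is uncontrolled off the nonnegative orthant. The
    argument therefore works on the simple functions below [f]. *)
Lemma ge0_integral_full_measure d (X : measurableType d) (mu : probability X R)
    (G : set X) (f : X -> \bar R) : measurable G -> mu G = 1 ->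
  (forall x, 0 <= f x) -> \int[mu]_x f x = \int[mu]_(x in G) f x.
Proof.
move=> mG muG f0; apply/eqP; rewrite eq_le; apply/andP; split; last first.
  rewrite integral_mkcond; apply: ge0_le_integral_nomeas => x _; first exact: erestrict_ge0.
  by rewrite patchE; case: ifP.
rewrite ge0_integralTE//; apply: ge_ereal_sup => _ [h hf <-].
rewrite -integralT_nnsfun.
have muGC : mu (~` G) = 0 by rewrite probability_setC// muG subee.
have mh : measurable_fun setT (EFin \o h) by apply/measurable_EFinP.
have h0 x : setT x -> 0 <= (EFin \o h) x by rewrite lee_fin.
rewrite (ge0_negligible_integral (measurableC mG) measurableT mh h0 muGC).
rewrite setTD setCK; apply: ge0_le_integral_nomeas => x _; last exact: hf.
by rewrite lee_fin.
Qed.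

Lemma integral_full_measure d (X : measurableType d) (mu : probability X R)
    (G : set X) (f : X -> \bar R) : measurable G -> mu G = 1 ->
  \int[mu]_x f x = \int[mu]_(x in G) f x.
Proof.
move=> mG muG; rewrite integralE [RHS]integralE.
by congr (_ - _); apply: ge0_integral_full_measure.
Qed.

Variable m' : nat.
Local Notation m := m'.+1.
Notation T := (m.-tuple R).
Let M : R := m%:R.

Lemma gap_space_nonneg (y : T) : @gap_space R m y -> nonneg_gaps y.
Proof. by move=> hy i; exact/ltW/hy. Qed.

Lemma measurable_gap_space : measurable (@gap_space R m).
Proof.
rewrite (_ : @gap_space R m = \bigcap_(i in [set: 'I_m])
   (setT `&` (fun y : T => tnth y i) @^-1` `]0%R, +oo[%classic)).
  apply: fin_bigcap_measurable => [|i _]; first exact: finite_finset.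
  by apply: measurable_tnth => //; exact: measurable_itv.
apply/seteqP; split => y hy i => [_|]; first by split => //=; rewrite in_itv/= andbT.
by have [_] := hy i I; rewrite /= in_itv/= andbT.
Qed.

Lemma sftl_PmuE (mu : probability T R) (t : R) (A : set T) : mu (@gap_space R m) = 1 ->
  sftl_Pmu mu t A = \int[mu]_y clamped_P A t y.
Proof.
move=> muG; rewrite /sftl_Pmu (integral_full_measure _ measurable_gap_space muG).
rewrite [RHS](integral_full_measure _ measurable_gap_space muG).
apply: eq_integral => y /set_mem hy; apply: sftl_P_clamped.
exact: gap_space_nonneg.
Qed.

Lemma clamped_P_clamp A (t : R) (y : T) : clamped_P A t (clamp_gaps y) = clamped_P A t y.
Proof. by rewrite /clamped_P (clamp_gaps_id (clamp_gaps_ge0 y)). Qed.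

Lemma Pmu_le_Pmu (mu nu : probability T R) (t : R) (A : set T) :
  measurable A -> (0 <= t)%R ->
  \int[mu]_y clamped_P A t y <= \int[nu]_y clamped_P A t y +
    (2 * (expR (- ((56 * M)^-1 * t)) * (56 * M)))%:E.
Proof.
move=> mA t0; set eps := (2 * _)%R.
have eps0 : (0 <= eps)%R by rewrite !mulr_ge0 ?expR_ge0.
have mP : measurable_fun setT (clamped_P A t).
  exact: (measurable_fun_pair2 t (measurable_clamped_P mA)).
have P0 y : 0 <= clamped_P A t y by exact: clamped_P_ge0.
have close y z : clamped_P A t y <= clamped_P A t z + eps%:E.
  rewrite -(clamped_P_clamp A t y) -(clamped_P_clamp A t z).
  by apply: clamped_P_close => //; exact: clamp_gaps_ge0.
have step z : \int[mu]_y clamped_P A t y <= clamped_P A t z + eps%:E.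
  apply: (@le_trans _ _ (\int[mu]_y (cst (clamped_P A t z + eps%:E) y))).
    by apply: ge0_le_integral_nomeas => y _ //; exact: close.
  by rewrite integral_cst//= probability_setT mule1.
have I0 : 0 <= \int[mu]_y clamped_P A t y by exact: integral_ge0.
apply: (@le_trans _ _ (\int[nu]_z (cst (\int[mu]_y clamped_P A t y) z))).
  by rewrite integral_cst//= probability_setT mule1.
apply: (@le_trans _ _ (\int[nu]_z (clamped_P A t z + eps%:E))).
  by apply: ge0_le_integral_nomeas => z _ //; exact: step.
rewrite ge0_integralD//; rewrite leeD2l//.
by rewrite integral_cst//= probability_setT mule1.
Qed.

Lemma Pmu_le1 (mu : probability T R) (t : R) (A : set T) : measurable A -> (0 <= t)%R ->
  0 <= \int[mu]_y clamped_P A t y <= 1.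
Proof.
move=> mA t0; have P0 y : 0 <= clamped_P A t y by exact: clamped_P_ge0.
apply/andP; split; first exact: integral_ge0.
apply: (@le_trans _ _ (\int[mu]_y (cst 1 y))).
  apply: ge0_le_integral_nomeas => y _ //; rewrite -clamped_P_clamp.
  by apply: clamped_P_le1 => //; exact: clamp_gaps_ge0.
by rewrite integral_cst//= probability_setT mule1.
Qed.

Variable pi : probability T R.
Hypothesis pi_stat : sftl_stationary pi.

Lemma pi_clamped (t : R) (A : set T) : measurable A -> (0 <= t)%R ->
  pi A = \int[pi]_y clamped_P A t y.
Proof. by move=> mA t0; have [h1 h2] := pi_stat; rewrite -sftl_PmuE// h2. Qed.

(** By stationarity [pi] is an average of transition probabilities too, so both terms of the
    difference are averages of one nearly constant function of the starting point. *)
Lemma sftl_d_le (t : R) : (0 <= t)%R ->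
  sftl_d pi t <= (2 * (expR (- ((56 * M)^-1 * t)) * (56 * M)))%:E.
Proof.
move=> t0; apply: ge_ereal_sup => _ [mu /= mug <-].
apply: ge_ereal_sup => _ [A /= mA <-].
rewrite sftl_PmuE// (pi_clamped mA t0).
have h1 := Pmu_le_Pmu mu pi mA t0; have h2 := Pmu_le_Pmu pi mu mA t0.
have /andP[a0 a1] := Pmu_le1 mu mA t0; have /andP[b0 b1] := Pmu_le1 pi mA t0.
have fa : \int[mu]_y clamped_P A t y \is a fin_num.
  by rewrite ge0_fin_numE// (le_lt_trans a1) ?ltry.
have fb : \int[pi]_y clamped_P A t y \is a fin_num.
  by rewrite ge0_fin_numE// (le_lt_trans b1) ?ltry.
move: h1 h2; rewrite -(fineK fa) -(fineK fb) -!EFinD !lee_fin => h1 h2.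
rewrite ler_norml; apply/andP; split; move: h1 h2; lra.
Qed.

Lemma sftl_tmix_le_log : sftl_tmix pi <= (56 * M * ln (2 ^+ 9 * M))%:E.
Proof.
have M0 : (0 < M)%R by rewrite ltr0n.
have M1 : (1 <= M)%R by rewrite ler1n.
set t := (56 * M * ln (2 ^+ 9 * M))%R.
have t0 : (0 <= t)%R.
  (* At this [t] the exponential equals 1/(512 M), and the distance bound becomes 112/512 = 7/32,
     just below 1/4. *)
  have h9 : (1 <= 2 ^+ 9 * M)%R by rewrite mulr_ege1// exprn_ege1// ler1n.
  by rewrite mulr_ge0 ?ln_ge0// mulr_ge0// ltW.
apply: ereal_inf_lbound; exists t => //=; split => //.
apply: (le_trans (sftl_d_le t0)); rewrite lee_fin /t mulKf ?gt_eqF ?mulr_gt0//.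
have p9 : (0 < 2 ^+ 9 * M)%R by rewrite mulr_gt0 ?exprn_gt0.
rewrite expRN lnK ?posrE//.
have -> : (2 * ((2 ^+ 9 * M)^-1 * (56 * M)) = 7 / 32)%R by field; rewrite gt_eqF.
by lra.
Qed.

(** The last gap is positive almost surely under [pi], so continuity from below yields [delta]. It
    may depend on the number of particles, which is harmless since the bound of [clamped_P_last_gap]
    does not involve it. *)
Lemma last_gap_mass : exists delta : R, (0 < delta <= 1)%R /\
  (7 / 8)%:E <= pi (@last_gap_set R m' delta).
Proof.
pose F (k : nat) : set T := @last_gap_set R m' (k.+1%:R^-1).
have mF k : measurable (F k) by exact: measurable_last_gap_set.
have mU : measurable (\bigcup_k F k) by exact: bigcup_measurable.
have ndF : nondecreasing_seq F.
  move=> a b ab; apply/subsetPset => y; rewrite /F /last_gap_set/=.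
  by apply: le_lt_trans; rewrite lef_pV2 ?posrE// ler_nat.
have piU : pi (\bigcup_k F k) = 1.
  apply/eqP; rewrite eq_le probability_le1//=.
  have [<- _] := pi_stat; apply: le_measure; rewrite ?inE//; first exact: measurable_gap_space.
  move=> y /(_ ord_max) y0.
  exists (Num.bound (tnth y ord_max)^-1) => //; rewrite /F /last_gap_set/=.
  rewrite -[ltRHS]invrK ltf_pV2 ?posrE ?invr_gt0//.
  apply: (lt_trans (archi_boundP _)); first by rewrite invr_ge0 ltW.
  by rewrite ltr_nat.
have cv : (pi \o F) k @[k --> \oo] --> (1 : \bar R).
  by rewrite -piU; exact: nondecreasing_cvg_mu.
have [k hk] : exists k, (7 / 8)%:E <= pi (F k).
  case: (pselect (exists k, (7 / 8)%:E <= pi (F k))) => // /forallNP hF.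
  have : (1 : \bar R) <= (7 / 8)%:E.
    rewrite -(cvg_lim _ cv)//; apply: lime_le; first exact: cvgP cv.
    by apply: nearW => k; apply: ltW; rewrite ltNge; apply/negP; exact: hF.
  by rewrite lee_fin; lra.
exists (k.+1%:R^-1)%R; split => //.
by rewrite invr_gt0 ltr0n/= invf_le1// ler1n.
Qed.

Lemma sftl_tmix_ge : (((m'.+2)%:R / 2 ^+ 8)%:E <= sftl_tmix pi).
Proof.
apply: le_ereal_inf_tmp => _ [t /= [t0 td] <-].
rewrite lee_fin leNgt; apply/negP => tlt.
have [delta [d01 hpi]] := last_gap_mass; have [d0 d1] := andP d01.
(* Equal gaps with total exactly [delta], strictly positive so that the Dirac mass at [y] is an
   admissible initial law. *)
pose y : T := [tuple (delta / M)%R | _ < m].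
have M0 : (0 < M)%R by rewrite ltr0n.
have yg : @gap_space R m y by move=> i; rewrite tnth_mktuple divr_gt0.
have y0 := gap_space_nonneg yg.
pose mu : probability T R := dirac y.
have mug : mu (@gap_space R m) = 1 by rewrite /mu/= diracE mem_set.
have mA := @measurable_last_gap_set R m' delta.
have Pmu : sftl_Pmu mu t (@last_gap_set R m' delta) = clamped_P (@last_gap_set R m' delta) t y.
  rewrite sftl_PmuE// integral_dirac//; last first.
    exact: (measurable_fun_pair2 t (measurable_clamped_P mA)).
  by rewrite diracT mul1e.
have Ple : clamped_P (@last_gap_set R m' delta) t y <= (4^-1)%:E.
  apply: (le_trans (@clamped_P_last_gap R m' delta d01 t y t0 y0 _)).
    rewrite (eq_bigr (fun=> delta / M)%R) => [|i _]; last by rewrite tnth_mktuple.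
    by rewrite sumr_const card_ord -mulr_natr divfK// gt_eqF.
  rewrite lee_fin /front_const.
  (* Since 65/256 < 1/2, the exponent is at most (m'+2)/2, and exp(1/2) <= 2. The final bound is
     then 16/65 times 16^(-m'), below 1/4, while [pi] gives mass at least 7/8. *)
  have e65 : (expR (65 * t) <= 2 ^+ m'.+2)%R.
    apply: (@le_trans _ _ (expR 2^-1 ^+ m'.+2)%R); last first.
      by rewrite lerXn2r ?nnegrE ?expR_ge0//; exact: expR_half_le2.
    rewrite -expRM_natl ler_expR; move: tlt; rewrite ltr_pdivlMr ?exprn_gt0// !exprS expr0.
    by move: t0; lra.
  have h32 : (2 ^+ m' * 32^-1 ^+ m' <= 1 :> R)%R.
    by rewrite -exprMn exprn_ile1//; lra.
  have c0 : (0 <= 32^-1 ^+ m' :> R)%R by rewrite exprn_ge0// invr_ge0.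
  apply: (@le_trans _ _ (2 ^+ m'.+2 * (4 / 65 * 32^-1 ^+ m'))%R).
    by rewrite ler_wpM2r// mulr_ge0// divr_ge0.
  rewrite !exprS; move: h32; lra.
have : (4^-1)%:E < sftl_d pi t.
  apply: (@lt_le_trans _ _ `|sftl_Pmu mu t (@last_gap_set R m' delta) - pi (@last_gap_set R m' delta)|).
    rewrite Pmu; have P0 := clamped_P_ge0 (@last_gap_set R m' delta) t y.
    have pfin : clamped_P (@last_gap_set R m' delta) t y \is a fin_num.
      by rewrite ge0_fin_numE// (le_lt_trans Ple) ?ltry.
    have pifin : pi (@last_gap_set R m' delta) \is a fin_num by exact: fin_num_measure.
    move: Ple hpi; rewrite -(fineK pfin) -(fineK pifin) !lee_fin => Ple hpi.
    rewrite -?EFinN -?EFinD /= lte_fin ltr_normr; apply/orP; right.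
    move: Ple hpi; lra.
  apply: (@le_trans _ _ (tv_dist (sftl_Pmu mu t) pi)).
    by apply: ereal_sup_ubound; exists (@last_gap_set R m' delta).
  by apply: ereal_sup_ubound; exists mu.
by rewrite ltNge; move: td; rewrite div1r => ->.
Qed.

End total_variation.

Theorem theorem3p4 (R : realType) :
  exists c1 c2 : R, 0 < c1 /\ 0 < c2 /\
    forall n : nat, (2 <= n)%N ->
    forall pi : probability ((n.-1).-tuple R) R,
      sftl_stationary pi ->
      ((c1 * n%:R)%:E <= sftl_tmix pi)%E /\
      (sftl_tmix pi <= (c2 * n%:R * (ln n%:R) ^+ 2)%:E)%E.
Proof.
(* The upper bound obtained is 560 N ln N; as ln N >= 1/2, the second logarithm costs a factor 2,
   and 1120 <= 2^11. *)
exists (2 ^+ 8)^-1, (2 ^+ 11); split; first by rewrite invr_gt0 exprn_gt0.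
split; first by rewrite exprn_gt0.
move=> [//|[//|m']] _ pi pi_stat; split.
  by rewrite mulrC; exact: sftl_tmix_ge.
apply: (le_trans (sftl_tmix_le_log pi_stat)); rewrite lee_fin.
set M : R := m'.+1%:R; set N : R := m'.+2%:R.
have M1 : 1 <= M by rewrite ler1n.
have MN : M <= N by rewrite ler_nat.
have N2 : 2 <= N by rewrite ler_nat.
have ln2 : 2^-1 <= ln 2 :> R.
  by rewrite -ler_expR lnK ?posrE//; exact: expR_half_le2.
have lnN : ln 2 <= ln N :> R by rewrite ler_ln ?posrE// (lt_le_trans _ N2).
have lnM9 : ln (2 ^+ 9 * M) <= 10 * ln N.
  apply: (@le_trans _ _ (ln (2 ^+ 9 * N))).
    by rewrite ler_ln ?posrE ?mulr_gt0 ?exprn_gt0 ?(lt_le_trans _ N2) ?(lt_le_trans _ M1)// ler_wpM2l// exprn_ge0.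
  have -> : ln (2 ^+ 9 * N) = 9 * ln 2 + ln N.
    by rewrite lnM ?posrE ?exprn_gt0 ?(lt_le_trans _ N2)// lnXn// mulr_natl.
  by move: lnN; lra.
have L0 : 2^-1 <= ln N by exact: le_trans lnN.
apply: (@le_trans _ _ (56 * N * (10 * ln N))).
  apply: ler_pM => //; first by rewrite mulr_ge0// (le_trans _ M1).
    by rewrite ln_ge0// mulr_ege1// exprn_ege1// ler1n.
  by rewrite ler_wpM2l.
have NL0 : 0 <= N * ln N by rewrite mulr_ge0 ?(le_trans _ N2)// (le_trans _ L0)// invr_ge0.
have -> : 2 ^+ 11 * N * ln N ^+ 2 = 2 ^+ 11 * (N * ln N) * ln N by ring.
have : N * ln N * 2^-1 <= N * ln N * ln N by rewrite ler_wpM2l.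
rewrite !exprS expr0; move: NL0; lra.
Qed.
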